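(* Let $V$ be a positive random variable independent of the Lévy process $J(\cdot)$ described in the context, let $W(t)=V+J(t)$ and $\tau=\inf\{t\ge 0: W(t)=0\}$. Let $f$ be a nonnegative Borel function on $\mathbb{R}_+$, and put $$A_f=\int_0^\tau f(W(t))\,\mathrm{d}t,\qquad D_f=\sum_{t\in[0,\tau]:\,W(t-)<W(t)} f(W(t-)).$$ Then, with $\lambda\equiv\nu\{(0,\infty)\}\in[0,\infty]$, $$\mathbb{E}D_f=\lambda\,\mathbb{E}A_f,$$ with the convention that $0\cdot\infty=0$.
   Context: $J(\cdot)$ is a Lévy process (càdlàg, $J(0)=0$) that is the superposition of a subordinator and an independent drifted Brownian motion; its Laplace exponent is $$\varphi(\alpha)\equiv-\log\mathbb{E}e^{-\alpha J(1)}=c\alpha-\frac{\sigma^2\alpha^2}{2}-\int_{(0,\infty)}(e^{-\alpha y}-1)\,\nu(\mathrm{d}y),\qquad \alpha\ge0,$$ where $c\in\mathbb{R}$, $\sigma\ge0$ and $\nu$ is a Borel measure on $(0,\infty)$ with $\int_{(0,\infty)}(1\wedge y)\,\nu(\mathrm{d}y)<\infty$. Standing assumption: $\varrho\equiv\mathbb{E}J(1)=\varphi'(0+)=c+\int_{(0,\infty)}y\,\nu(\mathrm{d}y)$ is finite and negative. $W(t-)$ denotes the left limit of $W$ at $t$. $\mathbb{R}_+=[0,\infty)$. *)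

(* Defs.v *)
From HB Require Import structures.
From mathcomp Require Import all_boot all_order all_algebra.
From mathcomp Require Import all_classical all_reals all_analysis.

Set Implicit Arguments.
Unset Strict Implicit.
Unset Printing Implicit Defensive.

Import Order.TTheory GRing.Theory Num.Theory.
Import numFieldNormedType.Exports.
Local Open Scope classical_set_scope.
Local Open Scope ring_scope.

(* Continuous-time processes are families X : R -> {RV P >-> R}; only the
   times t >= 0 are ever constrained or used. *)

Section Independence.
Context {d : measure_display} {T : measurableType d} {R : realType}.
Variable P : probability T R.

Definition indep_systems (F G : set (set T)) : Prop :=
  forall A B, F A -> G B -> P (A `&` B) = (P A * P B)%E.

Definition sigma_RV (X : T -> R) : set (set T) :=
  preimage_set_system setT X measurable.

Definition sigma_process (I : set R) (X : R -> {RV P >-> R}) : set (set T) :=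
  <<s \bigcup_(t in I) sigma_RV (X t) >>.

End Independence.

Section LevyProcesses.
Context {d : measure_display} {T : measurableType d} {R : realType}.
Variable P : probability T R.

Definition cadlag (w : R -> R) : Prop :=
  (forall t, 0 <= t -> w x @[x --> t^'+] --> w t) /\
  (forall t, 0 < t -> cvg (w x @[x --> t^'-])).

Definition increment (X : R -> {RV P >-> R}) (s t : R) : T -> R :=
  fun w => X t w - X s w.

Record levy_process (X : R -> {RV P >-> R}) : Prop := LevyProcess {
  levy_cadlag : forall w, cadlag (X ^~ w) ;
  levy_start : forall w, X 0 w = 0 ;
  levy_stationary : forall s t : R, 0 <= s -> s <= t ->
    forall A : set R, measurable A ->
      P (increment X s t @^-1` A) = distribution P (X (t - s)) A ;
  levy_independent : forall s t : R, 0 <= s -> s <= t ->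
    indep_systems P (sigma_RV (increment X s t)) (sigma_process `[0, s] X) }.

Definition subordinator (S : R -> {RV P >-> R}) : Prop :=
  levy_process S /\
  forall w s t, 0 <= s -> s <= t -> S s w <= S t w.

(* The normal law N(m, s^2), a point mass when s = 0; the library's
   [normal_prob m 0] is the uniform law on [0, 1]. *)
Definition gaussian_law (m s : R) (A : set R) : \bar R :=
  if s == 0 then \d_m A else normal_prob m s A.

(* mu t + s B(t) with B a standard Brownian motion; s = 0 is allowed, and then
   the probability space need not carry any Brownian motion. *)
Definition drifted_brownian_motion (mu s : R) (B : R -> {RV P >-> R}) : Prop :=
  [/\ levy_process B,
      forall w, {within `[0, +oo[, continuous (B ^~ w)} &
      forall t, 0 <= t -> forall A : set R, measurable A ->
        distribution P (B t) A = gaussian_law (mu * t) (s * Num.sqrt t) A].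

Definition subordinator_plus_brownian (J : R -> {RV P >-> R}) : Prop :=
  exists S B : R -> {RV P >-> R}, exists mu s : R,
    [/\ subordinator S,
        0 <= s /\ drifted_brownian_motion mu s B,
        indep_systems P (sigma_process `[0, +oo[ S) (sigma_process `[0, +oo[ B)
      & forall t w, 0 <= t -> J t w = S t w + B t w].

Definition laplace_exponent (J : R -> {RV P >-> R}) (a : R) : \bar R :=
  (- lne 'E_P[(fun w => expR (- a * J 1 w))%R])%E.

End LevyProcesses.

Section Triplet.
Context {R : realType}.

(* A measure on (0, oo) is represented by a Borel measure on R of which only
   the restriction to (0, oo) is used. *)
Definition jump_measure (nu : {measure set R -> \bar R}) : Prop :=
  (\int[nu]_(y in `]0%R, +oo[) (Num.min 1 y)%:E < +oo)%E.

Definition levy_exponent (c sigma : R) (nu : {measure set R -> \bar R})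
    (a : R) : \bar R :=
  ((c * a - sigma ^+ 2 * a ^+ 2 / 2)%:E
   - \int[nu]_(y in `]0%R, +oo[) (expR (- a * y) - 1)%:E)%E.

Definition jump_rate (nu : {measure set R -> \bar R}) : \bar R :=
  nu `]0%R, +oo[%classic.

End Triplet.

Section Paths.
Context {R : realType}.
Implicit Types (f w : R -> R).

(* Equal to +oo when the path never vanishes. *)
Definition hitting_time0 w : \bar R :=
  ereal_inf [set t%:E | t in [set t : R | 0 <= t /\ w t = 0]].

(* With the usual convention w(0-) = w(0): there is no jump at time 0. *)
Definition left_limit w (t : R) : R :=
  if t == 0 then w 0 else lim (w x @[x --> t^'-]).

(* [0, tau], read as [0, oo) when tau = +oo. *)
Definition until0 w : set R :=
  [set t | 0 <= t /\ (t%:E <= hitting_time0 w)%E].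

Definition area_functional f w : \bar R :=
  \int[lebesgue_measure]_(t in until0 w) (f (w t))%:E.

Definition jump_functional f w : \bar R :=
  \esum_(t in until0 w `&` [set t | left_limit w t < w t])
    (f (left_limit w t))%:E.

End Paths.

(* Main.v *)
Require Import Defs.
From HB Require Import structures.
From mathcomp Require Import all_boot all_order all_algebra.
From mathcomp Require Import all_classical all_reals all_analysis.
From mathcomp Require Import measurable_realfun lra ring.
Set Implicit Arguments.
Unset Strict Implicit.
Unset Printing Implicit Defensive.
Import Order.TTheory GRing.Theory Num.Theory.
Import numFieldNormedType.Exports.
Local Open Scope classical_set_scope.
Local Open Scope ring_scope.

Import HBNNSimple.

(** The identity is a compensation formula: the jumps of [J] come at rate
    [lambda], independently of the past, while at a jump time [t] the factor
    [f (W (t-))], restricted to the times before passage, is known just before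
    [t]. It is proved here without a description of the jumps of [J] as a
    Poisson process, from the Laplace exponent and by discretization.

    Split time into cells of length [h = 2 ^ - n] and let [phi] be a continuous
    weight vanishing near [0]. The sum over the cells of
    [f (W (t_k)) * phi (J (t_k + h) - J (t_k))] converges along each cadlag path
    to the sum over the jumps of [f (W (t-)) * phi (jump at t)]
    ([grid_sum_cvg]). By independence its expectation is
    [E phi (J h) / h] times the expectation of a Riemann sum of [f (W t)]
    ([jump_sum_limit]). This proves, for continuous [f], the identity with jumps
    weighted by [phi] and with the expected [phi]-weighted number of jumps
    per unit of time in place of [lambda] ([continuous_compensation]).

    Two facts about the weight [(1 - exp (- m z)) ^ 4], which dominates all the
    [phi] considered, make this work. Its expectation at [z = J h], and that of
    its square, are combinations of Laplace transforms, hence explicit and of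
    order [h]; so the sums over the grid are bounded in L2, and expectations
    converge ([cvg_expectation_second_moment]). Moreover its expectation
    divided by [h] tends to its integral against [nu], because fourth
    differences of the Laplace exponent see neither the drift nor the
    Gaussian part ([fourth_difference_psi]). Truncating it near [0] changes the
    expectation by little ([jump_intensity_quartic]); letting [m] tend to
    infinity turns the weight into [1] for all positive jumps, and its
    integral into [lambda] ([killed_compensation]). The passage from
    continuous to Borel functions is a monotone class argument
    ([compensated_nonneg]).

    Killing has to be predictable, so it is done at the first time when the
    path or its left limit reaches [0] ([horizon]). This is the first passage
    time of the theorem unless the path jumps upwards from level [0] at that
    time. The identity for the indicator of [0], whose area functional
    vanishes, shows that this almost never happens. Outside a null set the two
    notions agree ([until0_horizon]), since [J] has no negative jumps. *)

(** * Convergence of expectations *)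

Section SecondMoment.
Context {d : measure_display} {T : measurableType d} {R : realType}.
Variable P : probability T R.

Lemma bounded_cvg_expectation (Y : nat -> T -> R) (Z : T -> R) (K : R) :
  (forall n, measurable_fun setT (Y n)) ->
  (forall n w, 0 <= Y n w <= K) ->
  (forall w, Y n w @[n --> \oo] --> Z w) ->
  (\int[P]_w (Y n w)%:E)%E @[n --> \oo] --> (\int[P]_w (Z w)%:E)%E.
Proof.
move=> mY Yb YZ.
have mZ : measurable_fun setT Z.
  by apply: (measurable_fun_cvg (h := Y)) => // w _; exact: YZ.
have iK := finite_measure_integrable_cst P K (measurableT : measurable [set: T]).
have [] // := @dominated_convergence _ _ _ P setT measurableT
  (fun n w => (Y n w)%:E) (fun w => (Z w)%:E) (EFin \o cst K).
- by move=> n; exact/measurable_EFinP.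
- exact/measurable_EFinP.
- by apply: aeW => w _; apply: cvg_EFin; [exact: nearW|exact: YZ].
- apply: aeW => w n _; rewrite lee_fin.
  by have /andP[Y0 YK] := Yb n w; rewrite ger0_norm.
Qed.

(** Truncating at a level [K] loses at most [C / K] in expectation, uniformly
    in [n], by the second moment bound; the truncations converge by
    bounded convergence. *)
Lemma cvg_expectation_second_moment (Y : nat -> T -> R) (Z : T -> R) (C : R) :
  (forall n, measurable_fun setT (Y n)) ->
  (forall n w, 0 <= Y n w) ->
  (forall w, Y n w @[n --> \oo] --> Z w) ->
  (forall n, (\int[P]_w (Y n w ^+ 2)%:E <= C%:E)%E) ->
  (\int[P]_w (Z w)%:E < +oo)%E /\
  (\int[P]_w (Y n w)%:E)%E @[n --> \oo] --> (\int[P]_w (Z w)%:E)%E.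
Proof.
move=> mY Y0 YZ YC.
have mZ : measurable_fun setT Z.
  by apply: (measurable_fun_cvg (h := Y)) => // w _; exact: YZ.
have Z0 w : 0 <= Z w.
  by rewrite -(cvg_lim (@Rhausdorff R) (YZ w)); apply: limr_ge;
    [apply/cvg_ex; exists (Z w); exact: YZ|exact: nearW].
have C0 : 0 <= C.
  rewrite -lee_fin; apply: le_trans (YC 0%N).
  by apply: integral_ge0 => w _; rewrite lee_fin sqr_ge0.
have ZC : (\int[P]_w (Z w ^+ 2)%:E <= C%:E)%E.
  have fE w : limn_einf (fun n => (Y n w ^+ 2)%:E) = (Z w ^+ 2)%:E.
    apply: (fun h => (@cvg_limn_einf_sup R _ _ h).1).
    apply: cvg_EFin; first exact: nearW.
    by rewrite expr2; under eq_fun do rewrite expr2; apply: cvgM; exact: YZ.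
  apply: (@le_trans _ _ (\int[P]_w limn_einf (fun n => (Y n w ^+ 2)%:E))%E).
    by under [leRHS]eq_integral do rewrite fE.
  apply: (le_trans (fatou _ _ _ _)) => //.
  - by move=> n; apply/measurable_EFinP; exact: measurable_funX.
  - by move=> n w _; rewrite lee_fin sqr_ge0.
  - rewrite limn_einf_lim; apply: lime_le; first exact: is_cvg_einfs.
    apply: nearW => n; apply: le_trans (YC n).
    by apply: ereal_inf_lbound; exists n => /=.
have trunc (X : T -> R) (K : R) : measurable_fun setT X -> (forall w, 0 <= X w) ->
    (\int[P]_w (X w ^+ 2)%:E <= C%:E)%E -> 0 < K ->
    exists x y : R, [/\ (\int[P]_w (X w)%:E)%E = x%:E,
      (\int[P]_w (Num.min (X w) K)%:E)%E = y%:E & `|x - y| <= C / K].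
  move=> mX X0 XC K0.
  have mm : measurable_fun setT (fun w => Num.min (X w) K).
    by apply: measurable_minr => //; exact: measurable_cst.
  have m0 w : 0 <= Num.min (X w) K by rewrite le_min X0 ltW.
  have yfin : (\int[P]_w (Num.min (X w) K)%:E)%E \is a fin_num.
    rewrite ge0_fin_numE; last by apply: integral_ge0 => w _; rewrite lee_fin.
    apply: (@le_lt_trans _ _ (\int[P]_w (cst K%:E w))%E).
      apply: ge0_le_integral => //.
      - by move=> w _; rewrite lee_fin.
      - exact/measurable_EFinP.
      - by move=> w _; rewrite lee_fin ge_min lexx orbT.
    by rewrite integral_cst//= probability_setT mule1 ltry.
  have le1 : (\int[P]_w (Num.min (X w) K)%:E <= \int[P]_w (X w)%:E)%E.
    apply: ge0_le_integral => //.
    - by move=> w _; rewrite lee_fin.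
    - exact/measurable_EFinP.
    - exact/measurable_EFinP.
    - by move=> w _; rewrite lee_fin ge_min lexx.
  have le2 : (\int[P]_w (X w)%:E <= \int[P]_w (Num.min (X w) K)%:E + (C / K)%:E)%E.
    have : (\int[P]_w ((K^-1 * X w ^+ 2)%:E) <= (C / K)%:E)%E.
      under eq_integral do rewrite EFinM.
      rewrite ge0_integralZl_EFin//; last 3 first.
      - by move=> w _; rewrite lee_fin sqr_ge0.
      - by apply/measurable_EFinP; exact: measurable_funX.
      - by rewrite invr_ge0 ltW.
      by rewrite muleC EFinM lee_wpmul2r// lee_fin invr_ge0 ltW.
    move=> h; apply: le_trans (leeD2l _ h).
    rewrite -ge0_integralD//; last 4 first.
    - by move=> w _; rewrite lee_fin.
    - exact/measurable_EFinP.
    - by move=> w _; rewrite lee_fin mulr_ge0// ?sqr_ge0// invr_ge0 ltW.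
    - apply/measurable_EFinP; apply: measurable_funM => //.
      exact: measurable_funX.
    apply: ge0_le_integral => //.
    - by move=> w _; rewrite lee_fin.
    - exact/measurable_EFinP.
    - apply: emeasurable_funD; apply/measurable_EFinP => //.
      by apply: measurable_funM => //; exact: measurable_funX.
    - move=> w _; rewrite -EFinD lee_fin; have [XK|KX] := leP (X w) K.
        by rewrite lerDl mulr_ge0// ?sqr_ge0// invr_ge0 ltW.
      apply: (@le_trans _ _ (K^-1 * X w ^+ 2)); last by rewrite lerDr ltW.
      rewrite mulrC ler_pdivlMr// expr2 ler_wpM2l//; exact: ltW.
  have xfin : (\int[P]_w (X w)%:E)%E \is a fin_num.
    rewrite ge0_fin_numE; last by apply: integral_ge0 => w _; rewrite lee_fin.
    by apply: le_lt_trans le2 _; rewrite lte_add_pinfty ?ltry// -ge0_fin_numE//;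
      apply: integral_ge0 => w _; rewrite lee_fin.
  exists (fine (\int[P]_w (X w)%:E)%E), (fine (\int[P]_w (Num.min (X w) K)%:E)%E).
  rewrite !fineK//; split => //.
  move: le1 le2; rewrite -(fineK xfin) -(fineK yfin) -EFinD !lee_fin/= => le1 le2.
  by rewrite ger0_norm ?subr_ge0// lerBlDl.
have [x [_ [xE _ _]]] := trunc _ 1 mZ Z0 ZC ltr01.
split; first by rewrite xE ltry.
rewrite xE; apply: cvg_EFin.
  apply: nearW => n.
  by have [y [_ [-> _ _]]] := trunc _ 1 (mY n) (Y0 n) (YC n) ltr01.
apply/cvgrPdist_lt => e e0.
(* [C + 1] instead of [C] keeps [K] positive. *)
pose K := 3 * (C + 1) / e.
have C10 : 0 < C + 1 by rewrite ltr_wpDl.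
have K0 : 0 < K by rewrite divr_gt0// mulr_gt0.
have CK : C / K < e / 3.
  rewrite /K invf_div mulrA ltr_pdivrMr ?mulr_gt0//.
  rewrite (_ : _ * (3 * _) = (C + 1) * e); last by field.
  by rewrite ltr_pM2r// ltrDl.
have [x' [y [x'E yE xy]]] := trunc _ K mZ Z0 ZC K0.
have ? : x' = x by move: x'E; rewrite xE => -[].
subst x'.
have : (\int[P]_w (Num.min (Y n w) K)%:E)%E @[n --> \oo] -->
       (\int[P]_w (Num.min (Z w) K)%:E)%E.
  apply: (@bounded_cvg_expectation _ _ K).
  - by move=> n; apply: measurable_minr.
  - by move=> n w; rewrite le_min Y0 (ltW K0) ge_min lexx orbT.
  - move=> w; rewrite minr_absE; under eq_fun do rewrite minr_absE.
    apply: cvgMl; apply: cvgB; first by apply: cvgD; [exact: YZ|exact: cvg_cst].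
    by apply: cvg_norm; apply: cvgB; [exact: YZ|exact: cvg_cst].
rewrite yE => /fine_cvgP[_]/cvgrPdist_lt/(_ (e / 3)).
move=> /(_ _)/filterS; apply; last by rewrite divr_gt0.
move=> n /=.
have [xn [yn [-> -> xyn]]] := trunc _ K (mY n) (Y0 n) (YC n) K0.
rewrite /= => yyn.
have -> : x - xn = (x - y) + (y - yn) - (xn - yn) by ring.
apply: le_lt_trans (ler_normB _ _) _.
apply: le_lt_trans (lerD (ler_normD _ _) xyn) _.
by lra.
Qed.
End SecondMoment.

(** * Cadlag paths along dyadic grids *)

Section OneSidedLimits.
Context {R : realType}.
Implicit Types (w : R -> R) (u t : R).

Lemma near_at_right_ball u (Q : R -> Prop) : (\forall x \near u^'+, Q x) ->
  exists2 r : R, 0 < r & forall x, u < x -> x < u + r -> Q x.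
Proof.
rewrite near_withinE => /nbhs_normP[r /= r0 Qr]; exists r => // x ux xr.
by apply: Qr => //=; rewrite ltr0_norm ?subr_lt0// opprB ltrBlDl.
Qed.

Lemma near_at_left_ball u (Q : R -> Prop) : (\forall x \near u^'-, Q x) ->
  exists2 r : R, 0 < r & forall x, u - r < x -> x < u -> Q x.
Proof.
rewrite near_withinE => /nbhs_normP[r /= r0 Qr]; exists r => // x xr xu.
by apply: Qr => //=; rewrite gtr0_norm ?subr_gt0// ltrBlDr -ltrBlDl.
Qed.

Lemma left_limitP w u : cadlag w -> 0 < u -> w x @[x --> u^'-] --> left_limit w u.
Proof. by move=> [_ wl] u0; rewrite /left_limit gt_eqF//; exact: wl. Qed.

Lemma cvg_right_seq w u (a : nat -> R) : w x @[x --> u^'+] --> w u ->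
  (forall n, u <= a n) -> a n @[n --> \oo] --> u ->
  w (a n) @[n --> \oo] --> w u.
Proof.
move=> wu ua au; apply/cvgrPdist_lt => e e0.
move/cvgrPdist_lt/(_ e e0) : wu => /near_at_right_ball[r r0 wr].
move/cvgrPdist_lt/(_ r r0) : au; apply: filterS => n /= anr.
have := ua n; rewrite le_eqVlt => /predU1P[<-|uan]; first by rewrite subrr normr0.
by apply: wr => //; move: anr; rewrite ltr0_norm ?subr_lt0// opprB ltrBlDl.
Qed.

(** The supremum of the horizons for which such a finite set exists is itself
    such a horizon, after adding to the set this time and one just before it,
    from where on the path stays close to its left limit. By right continuity
    it can be exceeded unless it is [M]. *)
Lemma cadlag_partition w (e M : R) : cadlag w -> 0 < e -> 0 <= M ->
  exists s : seq R, forall a b, 0 <= a -> a <= b -> b <= M ->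
    (forall u, u \in s -> ~ (a < u <= b)) -> `|w b - w a| < e.
Proof.
move=> cw e0 M0.
pose Q x := exists s : seq R, forall a b, 0 <= a -> a <= b -> b <= x ->
    (forall u, u \in s -> ~ (a < u <= b)) -> `|w b - w a| < e.
pose A := [set x | 0 <= x <= M /\ Q x].
have A0 : A 0.
  split; first by rewrite lexx.
  exists [::] => a b a0 ab b0 _.
  have -> : b = a by apply/eqP; rewrite eq_le (le_trans b0 a0) ab.
  by rewrite subrr normr0.
have supA : has_sup A by split; [exists 0|exists M => x [/andP[]]].
pose c := sup A.
have c0 : 0 <= c by apply: ub_le_sup => //; exact: supA.2.
have cM : c <= M by apply: ge_sup; [exists 0|move=> x [/andP[]]].
have Ac : Q c.
  move: c0; rewrite le_eqVlt => /predU1P[<-|c0]; first by have [] := A0.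
  have /cvgrPdist_lt/(_ (e / 2)) := left_limitP cw c0.
  rewrite divr_gt0// => /(_ isT)/near_at_left_ball[r r0 wr].
  have [x [/andP[x0 xM] [s Qs]] cx] := sup_adherent r0 supA.
  exists [:: c, x & s] => a b a0 ab bc nou.
  have [bx|xb] := leP b x.
    by apply: Qs => // u us; apply: nou; rewrite !inE us !orbT.
  have xa : x <= a.
    rewrite leNgt; apply/negP => ax; apply: (nou x); first by rewrite !inE eqxx orbT.
    by rewrite ax ltW.
  move: bc; rewrite le_eqVlt => /predU1P[bc|bc].
    have [ac|ca] := ltP a c.
      by exfalso; apply: (nou c); rewrite ?inE ?eqxx// ac bc lexx.
    have -> : b = a by apply/eqP; rewrite eq_le ab bc ca.
    by rewrite subrr normr0.
  have -> : w b - w a = (left_limit w c - w a) - (left_limit w c - w b) by ring.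
  apply: le_lt_trans (ler_normB _ _) _.
  rewrite (splitr e) ltrD// wr//.
  - exact: lt_le_trans cx xa.
  - exact: le_lt_trans ab bc.
  - exact: lt_trans cx xb.
have {}cM : c = M.
  apply/eqP; rewrite eq_le cM leNgt; apply/negP => {}cM.
  have /cvgrPdist_lt/(_ (e / 2)) := cw.1 c c0.
  rewrite divr_gt0// => /(_ isT)/near_at_right_ball[r r0 wr].
  pose y := Num.min M (c + r / 2).
  have cy : c < y by rewrite lt_min cM ltrDl divr_gt0.
  have yr : y < c + r.
    by rewrite gt_min ltrD2l gtr_pMr// invf_lt1 ?ltr1n// orbT.
  have wr' x : c <= x -> x <= y -> `|w c - w x| < e / 2.
    rewrite le_eqVlt => /predU1P[<-|cx xy]; first by rewrite subrr normr0 divr_gt0.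
    by apply: wr => //; exact: le_lt_trans yr.
  have : A y.
    split; first by rewrite (ltW (le_lt_trans c0 cy)) ge_min lexx.
    have [s Qs] := Ac; exists (c :: s) => a b a0 ab bc nou.
    have [bx|xb] := leP b c.
      by apply: Qs => // u us; apply: nou; rewrite !inE us !orbT.
    have xa : c <= a.
      rewrite leNgt; apply/negP => ax; apply: (nou c); first by rewrite !inE eqxx.
      by rewrite ax ltW.
    have -> : w b - w a = (w c - w a) - (w c - w b) by ring.
    apply: le_lt_trans (ler_normB _ _) _.
    rewrite (splitr e) ltrD// wr'//; [exact: le_trans bc|exact: ltW].
  by move=> /(ub_le_sup supA.2); rewrite -/c leNgt cy.
by rewrite -cM.
Qed.

End OneSidedLimits.

Section DyadicGrid.
Context {R : realType}.
Implicit Types (w : R -> R) (u t : R) (n k : nat).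

Definition grid n k : R := k%:R / 2 ^+ n.

(** Cells are open on the left, so that their left ends approach [u] strictly
    from below; this is the reason for the correction at grid points. *)
Definition cell n u : nat :=
  let t := u * 2 ^+ n in
  let m := Num.trunc t in if t == m%:R then m.-1 else m.

Lemma pow2_gt0 n : 0 < 2 ^+ n :> R. Proof. exact: exprn_gt0. Qed.

Lemma gridS n k : grid n k.+1 = grid n k + 2 ^- n.
Proof. by rewrite /grid -addn1 natrD mulrDl mul1r. Qed.

Lemma grid_ge0 n k : 0 <= grid n k.
Proof. by rewrite divr_ge0// ltW// pow2_gt0. Qed.

Lemma le_grid n j k : (j <= k)%N -> grid n j <= grid n k.
Proof. by move=> jk; rewrite ler_pM2r ?invr_gt0 ?pow2_gt0// ler_nat. Qed.

Lemma grid_cell n u : 0 < u -> grid n (cell n u) < u <= grid n (cell n u).+1.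
Proof.
move=> u0; rewrite /grid ltr_pdivrMr ?pow2_gt0// ler_pdivlMr ?pow2_gt0//.
have t0 : 0 < u * 2 ^+ n by rewrite mulr_gt0// pow2_gt0.
rewrite /cell; have /andP[lt tl] := truncn_itv (ltW t0).
case: eqP => [tm|/eqP tm]; last by rewrite lt_neqAle lt eq_sym tm ltW.
have m0 : (0 < Num.trunc (u * 2 ^+ n))%N by rewrite -(ltr_nat R) -tm.
by rewrite prednK// {3}tm lexx andbT {2}tm ltr_nat prednK.
Qed.

Lemma cell_unique n k u : grid n k < u <= grid n k.+1 -> k = cell n u.
Proof.
move=> /andP[ku uk]; have u0 := le_lt_trans (grid_ge0 n k) ku.
have /andP[cu uc] := grid_cell n u0.
apply/eqP; rewrite eqn_leq -ltnS -[X in _ && X]ltnS -2!(ltr_nat R).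
have p := pow2_gt0 n.
move: (lt_le_trans ku uc) (lt_le_trans cu uk).
by rewrite /grid !ltr_pM2r ?invr_gt0// => -> ->.
Qed.

Lemma cell_lt n u (M : nat) : 0 < u -> u <= M%:R -> (cell n u < M * 2 ^ n)%N.
Proof.
move=> u0 uM; have /andP[cu _] := grid_cell n u0.
move: (lt_le_trans cu uM); rewrite ltr_pdivrMr ?pow2_gt0//.
by rewrite -natrX -natrM ltr_nat.
Qed.

Lemma cvg_pow2V : (2 ^- n : R) @[n --> \oo] --> 0.
Proof.
have := @cvg_geometric R 1 2^-1; rewrite ger0_norm ?invr_ge0// invf_lt1 ?ltr1n//.
move=> /(_ isT); rewrite /geometric; apply: cvg_trans.
by apply: near_eq_cvg; apply: nearW => n; rewrite /= mul1r exprVn.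
Qed.

Lemma cvg_grid_cell u : 0 < u -> grid n (cell n u) @[n --> \oo] --> u.
Proof.
move=> u0; apply: (@squeeze_cvgr _ _ _ _ (fun n => u - 2 ^- n) (cst u)).
- apply: nearW => n; have /andP[cu uc] := grid_cell n u0.
  by rewrite lerBlDr -gridS uc ltW.
- have h : (cst u) n @[n --> \oo] --> u by exact: cvg_cst.
  have : u - 2 ^- n @[n --> \oo] --> u - 0 by exact: (cvgB h cvg_pow2V).
  by rewrite subr0.
- exact: cvg_cst.
Qed.

Lemma cvg_grid_cellS u : 0 < u -> grid n (cell n u).+1 @[n --> \oo] --> u.
Proof.
move=> u0; under eq_fun do rewrite gridS.
have : grid n (cell n u) + 2 ^- n @[n --> \oo] --> u + 0.
  exact: (cvgD (cvg_grid_cell u0) cvg_pow2V).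
by rewrite addr0.
Qed.

Lemma cvg_left_grid w u : cadlag w -> 0 < u ->
  w (grid n (cell n u)) @[n --> \oo] --> left_limit w u.
Proof.
move=> cw u0; have /cvg_at_leftP := left_limitP cw u0; apply; split.
- by move=> n; have /andP[] := grid_cell n u0.
- exact: cvg_grid_cell.
Qed.

Lemma cvg_right_grid w u : cadlag w -> 0 < u ->
  w (grid n (cell n u).+1) @[n --> \oo] --> w u.
Proof.
move=> cw u0; apply: cvg_right_seq; first by apply: cw.1; exact: ltW.
- by move=> n; have /andP[] := grid_cell n u0.
- exact: cvg_grid_cellS.
Qed.

Lemma near_uniq_cell (s : seq R) : uniq s -> (forall u, u \in s -> 0 < u) ->
  \forall n \near \oo, uniq [seq cell n u | u <- s].
Proof.
elim: s => [_ _|x s ih /=/andP[xs us] s0]; first exact: nearW.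
have {}ih := ih us (fun u us => s0 u (mem_behead (us : u \in behead (x :: s)))).
suff H : \forall n \near \oo, cell n x \notin [seq cell n u | u <- s].
  by near=> n; apply/andP; split; near: n.
have x0 : 0 < x by apply: s0; rewrite mem_head.
have {}s0 u : u \in s -> 0 < u by move=> us'; apply: s0; rewrite in_cons us' orbT.
elim: s xs s0 {us ih} => [_ _|y s ih]; first exact: nearW.
rewrite in_cons negb_or => /andP[xy xs] s0.
have y0 : 0 < y by apply: s0; rewrite mem_head.
have {}ih := ih xs (fun u us => s0 u (mem_behead (us : u \in behead (y :: s)))).
have dxy : 0 < `|x - y| by rewrite normr_gt0 subr_eq0.
have H : \forall n \near \oo, cell n x != cell n y.
  have /cvgrPdist_lt/(_ _ dxy) := cvg_pow2V; apply: filterS => n.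
  rewrite sub0r normrN ger0_norm ?invr_ge0 ?(ltW (pow2_gt0 n))//.
  apply: contraTN => /eqP cxy; rewrite -leNgt.
  have /andP[a b] := grid_cell n x0; have /andP[a' b'] := grid_cell n y0.
  move: a b a' b'; rewrite cxy gridS => a b a' b'.
  by rewrite ler_norml; apply/andP; split; lra.
near=> n; rewrite /= in_cons negb_or; apply/andP; split; near: n => //.
Unshelve. all: by end_near. Qed.

End DyadicGrid.

Section GridSums.
Context {R : realType}.
Implicit Types (w phi : R -> R) (u t : R) (n k : nat).

Definition jump w u := w u - left_limit w u.

Lemma big_support (N : nat) (t : seq nat) (a : nat -> R) : uniq t ->
  (forall k, k \in t -> (k < N)%N) ->
  (forall k, (k < N)%N -> k \notin t -> a k = 0) ->
  \sum_(k < N) a k = \sum_(k <- t) a k.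
Proof.
move=> ut tN a0; rewrite -(big_mkord predT) (bigID (mem t))/=.
rewrite [X in _ + X]big_seq_cond [X in _ + X]big1 ?addr0; last first.
  by move=> k /andP[]; rewrite mem_index_iota => /andP[_]; exact: a0.
rewrite -big_filter; apply: perm_big; apply: uniq_perm => //.
  by rewrite filter_uniq// iota_uniq.
move=> k; rewrite mem_filter mem_index_iota leq0n/=.
by case: (boolP (k \in t)) => // /tN ->.
Qed.

Lemma cvg_big_seq (I : eqType) (s : seq I) (a : nat -> I -> R) (b : I -> R) :
  (forall i, i \in s -> a n i @[n --> \oo] --> b i) ->
  \sum_(i <- s) a n i @[n --> \oo] --> \sum_(i <- s) b i.
Proof.
elim: s => [|i s ih] ab.
  by rewrite big_nil; under eq_fun do rewrite big_nil; exact: cvg_cst.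
rewrite big_cons; under eq_fun do rewrite big_cons.
apply: cvgD; first by apply: ab; rewrite mem_head.
by apply: ih => j js; apply: ab; rewrite in_cons js orbT.
Qed.

(** Since [phi] vanishes near [0], for a fine grid only the cells holding
    one of finitely many times contribute, and the increment over the cell
    holding [u] tends to the jump at [u]. *)
Lemma grid_sum_cvg w phi (X : nat -> nat -> R) (y : R -> R) (M : nat) (e : R) :
  cadlag w -> 0 < e -> (forall z, `|z| <= e -> phi z = 0) -> continuous phi ->
  (forall u, 0 < u -> u <= M%:R -> X n (cell n u) @[n --> \oo] --> y u) ->
  exists s : seq R, [/\ uniq s, forall u, u \in s -> 0 < u <= M%:R,
    forall u, 0 < u <= M%:R -> u \notin s -> phi (jump w u) = 0 &
    \sum_(k < M * 2 ^ n) X n k * phi (w (grid n k.+1) - w (grid n k))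
      @[n --> \oo] --> \sum_(u <- s) y u * phi (jump w u)].
Proof.
move=> cw e0 phi0 cphi Xy.
have [s0 ws0] := cadlag_partition cw e0 (ler0n _ M).
pose s := undup [seq u <- s0 | 0 < u <= M%:R].
have sM u : u \in s -> 0 < u <= M%:R.
  by rewrite mem_undup mem_filter => /andP[].
have us : uniq s by exact: undup_uniq.
have ws a b : 0 <= a -> a <= b -> b <= M%:R ->
    (forall u, u \in s -> ~ (a < u <= b)) -> `|w b - w a| < e.
  move=> a0 ab bM h; apply: ws0 => // u us0 /andP[au ub].
  apply: (h u); last by rewrite au ub.
  by rewrite mem_undup mem_filter us0 (le_lt_trans a0 au) (le_trans ub bM).
exists s; split => //.
- move=> u /andP[u0 uM] us'; apply: phi0.
  have near_s (t : seq R) : u \notin t ->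
      \forall x \near u^'-, forall v, v \in t -> v < u -> v < x.
    elim: t => [_|v t ih]; first exact: nearW.
    rewrite in_cons negb_or => /andP[uv ut]; have {}ih := ih ut.
    have H : \forall x \near u^'-, v < u -> v < x.
      have [vu|vu] := ltP v u; last by apply: nearW.
      by apply: filterS (nbhs_left_gt vu) => x vx.
    apply: filterS2 H ih => x H1 H2 z; rewrite in_cons => /predU1P[->//|]; exact: H2.
  have Hl : \forall x \near u^'-, `|w u - w x| <= e.
    have H0 : \forall x \near u^'-, 0 < x by exact: nbhs_left_gt.
    have H1 : \forall x \near u^'-, x < u by exact: nbhs_left_lt.
    apply: filterS3 (near_s s us') H0 H1 => x sx x0 xu.
    apply/ltW/ws => //; rewrite ?ltW// => v vs /andP[xv].
    rewrite le_eqVlt => /predU1P[vu|/(sx v vs)]; last by rewrite ltNge (ltW xv).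
    by move: us'; rewrite -vu vs.
  have cl : `|w u - w x| @[x --> u^'-] --> `|jump w u|.
    apply: cvg_norm; apply: cvgB; first exact: cvg_cst.
    exact: left_limitP.
  rewrite -(cvg_lim (@Rhausdorff R) cl); apply: limr_le => //.
  by apply/cvg_ex; exists `|jump w u|.
- have H : \forall n \near \oo,
      \sum_(u <- s) X n (cell n u) *
        phi (w (grid n (cell n u).+1) - w (grid n (cell n u))) =
      \sum_(k < M * 2 ^ n) X n k * phi (w (grid n k.+1) - w (grid n k)).
    have s_gt0 u : u \in s -> 0 < u by move=> /sM/andP[].
    apply: filterS (near_uniq_cell us s_gt0) => n un.
    pose a k := X n k * phi (w (grid n k.+1) - w (grid n k)).
    rewrite -/(a _) (@big_support _ [seq cell n u | u <- s] a) ?big_map//.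
      by move=> k /mapP[u /sM/andP[u0 uM] ->]; exact: cell_lt.
    move=> k kN kn; rewrite /a phi0 ?mulr0//; apply/ltW/ws.
    + exact: grid_ge0.
    + exact: le_grid.
    + rewrite /grid ler_pdivrMr ?pow2_gt0//.
      by rewrite -natrX -natrM ler_nat.
    + move=> u us' /cell_unique ku.
      by move: kn; rewrite ku map_f.
  apply: cvg_trans (near_eq_cvg H) _.
  apply: cvg_big_seq => u /sM/andP[u0 uM]; apply: cvgM; first exact: Xy.
  have cc : w (grid n (cell n u).+1) - w (grid n (cell n u)) @[n --> \oo] --> jump w u.
    by apply: cvgB; [exact: cvg_right_grid|exact: cvg_left_grid].
  exact: (@continuous_cvg _ _ _ _ _ _ phi _ (cphi _) cc).
Qed.

Lemma grid_sum_cvg_esum w phi (X : nat -> nat -> R) (y : R -> R) (M : nat) (e : R) :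
  cadlag w -> 0 < e -> (forall z, `|z| <= e -> phi z = 0) -> continuous phi ->
  (forall z, 0 <= phi z) -> (forall u, 0 < u <= M%:R -> 0 <= y u) ->
  (forall u, 0 < u -> u <= M%:R -> X n (cell n u) @[n --> \oo] --> y u) ->
  exists l : R,
    \esum_(u in `]0, M%:R]) (y u * phi (jump w u))%:E = l%:E /\
    \sum_(k < M * 2 ^ n) X n k * phi (w (grid n k.+1) - w (grid n k))
      @[n --> \oo] --> l.
Proof.
move=> cw e0 phi0 cphi phi_ge0 y_ge0 Xy.
have [s [us sM s0 cs]] := grid_sum_cvg cw e0 phi0 cphi Xy.
exists (\sum_(u <- s) y u * phi (jump w u)); split => //.
have ge0 u : `]0, M%:R]%classic u -> (0 <= (y u * phi (jump w u))%:E)%E.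
  by rewrite /= in_itv/= => uM; rewrite lee_fin mulr_ge0// y_ge0.
rewrite (esumID [set` s])//.
rewrite [X in (_ + X)%E]esum1 ?adde0; last first.
  by move=> u [/=]; rewrite in_itv/= => uM /negP us'; rewrite s0// mulr0.
rewrite (_ : _ `&` _ = [set` s]); last first.
  by rewrite setIidr// => u /= /sM; rewrite in_itv.
rewrite esum_fset//; last first.
  by move=> u; rewrite inE/= => /sM uM; apply: ge0; rewrite /= in_itv.
  exact: finite_seq.
by rewrite -fsbig_seq// sumEFin.
Qed.

Lemma grid_cells_cover n (M : nat) :
  `]0, M%:R]%classic = \big[setU/set0]_(k < M * 2 ^ n) `]grid n k, grid n k.+1]%classic :> set R.
Proof.
rewrite -(bigcup_mkord _ (fun k => `]grid n k, grid n k.+1]%classic)).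
apply/seteqP; split => u /=.
  rewrite in_itv/= => /andP[u0 uM]; exists (cell n u); first exact: cell_lt.
  by rewrite /= in_itv/= grid_cell.
case=> k /= kM; rewrite !in_itv/= => /andP[ku uk].
rewrite (le_lt_trans (grid_ge0 _ _) ku) (le_trans uk)//.
rewrite /grid ler_pdivrMr ?pow2_gt0//.
by rewrite -natrX -natrM ler_nat.
Qed.

Lemma right_continuous_step_cvg (g : R -> R) (u : R) :
  (forall t, 0 <= t -> g x @[x --> t^'+] --> g t) -> 0 < u ->
  g (grid n (cell n u).+1) @[n --> \oo] --> g u.
Proof.
move=> gc u0; apply: cvg_right_seq; first by apply: gc; exact: ltW.
- by move=> n; have /andP[] := grid_cell n u0.
- exact: cvg_grid_cellS.
Qed.

Lemma measurable_step (g : R -> R) n (M : nat) :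
  measurable_fun (`]0, M%:R] : set R) (fun u => g (grid n (cell n u).+1)).
Proof.
have mG' : measurable_fun (\bigcup_k `]grid n k, grid n k.+1]%classic)
    (fun u : R => g (grid n (cell n u).+1)).
  apply/measurable_fun_bigcup => [k|k]; first exact: measurable_itv.
  apply: (eq_measurable_fun (cst (g (grid n k.+1)))) => //.
  by move=> u; rewrite inE /= in_itv/= => /cell_unique ->.
apply: measurable_funS mG'; first by apply: bigcup_measurable => k _; exact: measurable_itv.
by rewrite (grid_cells_cover n M) -(bigcup_mkord _ (fun k => `]grid n k, grid n k.+1]%classic));
  exact: bigcup_subset.
Qed.

Lemma right_continuous_measurable (g : R -> R) (M : nat) :
  (forall t, 0 <= t -> g x @[x --> t^'+] --> g t) ->
  measurable_fun (`]0, M%:R] : set R) g.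
Proof.
move=> gc; apply: (measurable_fun_cvg (h := fun n u => g (grid n (cell n u).+1))) => [n|u /=].
  exact: measurable_step.
by rewrite in_itv/= => /andP[u0 _]; exact: right_continuous_step_cvg.
Qed.

(** Up to a boundary term of the order of the mesh, the sums are integrals of
    step functions evaluated at the dyadic point just above the argument, and
    these converge pointwise by right continuity. *)
Lemma riemann_sum_cvg (g : R -> R) (M : nat) (K : R) :
  (forall t, 0 <= t -> g x @[x --> t^'+] --> g t) ->
  (forall t, 0 <= t -> 0 <= g t <= K) ->
  (2 ^- n * \sum_(k < M * 2 ^ n) g (grid n k))%:E @[n --> \oo] -->
  (\int[lebesgue_measure]_(t in `]0%R, M%:R%R]) (g t)%:E)%E.
Proof.
move=> gc gK.
pose G n u := g (grid n (cell n u).+1).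
pose I n k : set R := `]grid n k, grid n k.+1]%classic.
have inI n k u : I n k u -> k = cell n u.
  by rewrite /I /= in_itv/= => /cell_unique.
have IU n : `]0, M%:R]%classic = \big[setU/set0]_(k < M * 2 ^ n) I n k.
  exact: grid_cells_cover.
have mG n : measurable_fun (`]0, M%:R] : set R) (G n) by exact: measurable_step.
have Gg u : `]0, M%:R]%classic u -> G n u @[n --> \oo] --> g u.
  by rewrite /= in_itv/= => /andP[u0 uM]; exact: right_continuous_step_cvg.
have mg : measurable_fun (`]0, M%:R] : set R) g by exact: right_continuous_measurable.
have G0 n u : `]0, M%:R]%classic u -> 0 <= G n u <= K.
  by move=> _; apply: gK; exact: grid_ge0.
have iG n : (\int[lebesgue_measure]_(t in `]0%R, M%:R%R]) (G n t)%:E)%E =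
    (2 ^- n * \sum_(k < M * 2 ^ n) g (grid n k.+1))%:E.
  have p := pow2_gt0 (R := R) n.
  rewrite {1}(IU n) -(big_mkord predT (I n)) ge0_integral_bigsetU//=; last 5 first.
  - by move=> k; exact: measurable_itv.
  - exact: iota_uniq.
  - by apply/trivIsetP => i j _ _ /eqP ij; rewrite -subset0 => u [/inI iu /inI ju]; apply: ij;
    rewrite iu ju.
  - apply/measurable_EFinP. rewrite big_mkord. rewrite -IU; exact: mG.
  - by move=> u; rewrite big_mkord -IU => /G0-/(_ n)/andP[+ _]; rewrite lee_fin.
  rewrite big_mkord mulr_sumr -sumEFin; apply: eq_bigr => k _.
  under eq_integral => u do [rewrite inE => /inI ku; rewrite /G -ku; over].
  rewrite integral_cst; last exact: measurable_itv.
  rewrite /I /= lebesgue_measure_itv/= lte_fin gridS ltrDl invr_gt0 p.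
  by rewrite -EFinD (addrC (grid n k)) addrK -EFinM mulrC.
have muM : lebesgue_measure (`]0, M%:R]%classic : set R) = M%:R%:E.
  rewrite lebesgue_measure_itv/= lte_fin; case: ltP => [_|].
    by rewrite -EFinD subr0.
  by move=> M0; congr (_%:E); apply/eqP; rewrite eq_le M0 ler0n.
have [gi _ dc] : [/\ lebesgue_measure.-integrable `]0%R, M%:R%R] (EFin \o g), True &
    (\int[lebesgue_measure]_(t in `]0%R, M%:R%R]) (G n t)%:E)%E @[n --> \oo] -->
    (\int[lebesgue_measure]_(t in `]0%R, M%:R%R]) (g t)%:E)%E].
  have [] // := @dominated_convergence _ _ _ (@lebesgue_measure R) `]0, M%:R]%classic _
    (fun n u => (G n u)%:E) (fun u => (g u)%:E) (EFin \o cst K).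
  - by move=> n; apply/measurable_EFinP; exact: mG.
  - exact/measurable_EFinP.
  - by apply: aeW => u uM; apply: cvg_EFin; [exact: nearW|exact: Gg].
  - apply: measurable_bounded_integrable => //; first by rewrite [X in (X < _)%E]muM ltry.
    by exists `|K|; split => // x /ltW Kx u _ /=.
  - apply: aeW => u n uM; rewrite lee_fin.
    by have /andP[Y0 YK] := G0 n u uM; rewrite ger0_norm.
have gfin : (\int[lebesgue_measure]_(t in `]0%R, M%:R%R]) (g t)%:E)%E \is a fin_num.
  exact: integrable_fin_num gi.
rewrite -(fineK gfin); apply: cvg_EFin; first exact: nearW.
move: dc; rewrite -(fineK gfin) => /fine_cvgP[_]; under eq_fun do rewrite iG.
move=> dc; rewrite /comp /=.
have gridM n : grid n (M * 2 ^ n) = M%:R :> R.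
  by rewrite /grid natrM natrX mulfK// gt_eqF// pow2_gt0.
have E n : 2 ^- n * (\sum_(k < M * 2 ^ n) g (grid n k)) =
    2 ^- n * (\sum_(k < M * 2 ^ n) g (grid n k.+1)) + 2 ^- n * (g 0 - g M%:R).
  rewrite -mulrDr; congr (_ * _); apply/eqP.
  rewrite addrC -subr_eq -sumrB -(big_mkord predT (fun k => g (grid n k) - g (grid n k.+1))).
  under eq_bigr do rewrite -opprB.
  by rewrite sumrN telescope_sumr// gridM /grid mul0r opprB.
have c0 : 2 ^- n * (g 0 - g M%:R) @[n --> \oo] --> 0 * (g 0 - g M%:R).
  exact: (cvgMl (cvg_pow2V (R := R))).
have h : 2 ^- n * (\sum_(k < M * 2 ^ n) g (grid n k.+1)) + 2 ^- n * (g 0 - g M%:R)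
    @[n --> \oo] -->
    fine (\int[lebesgue_measure]_(t in `]0%R, M%:R%R]) (g t)%:E)%E + 0 * (g 0 - g M%:R).
  by apply: cvgD c0; apply: cvg_trans dc; apply: near_eq_cvg; apply: nearW => n /=.
rewrite mul0r addr0 in h; apply: cvg_trans h.
by apply: near_eq_cvg; apply: nearW => n; rewrite /= E.
Qed.

End GridSums.

(** * Independence *)

Section Independence.
Context {d : measure_display} {T : measurableType d} {R : realType}.
Variable P : probability T R.

(** Dynkin's pi-lambda argument, in the form of uniqueness of measures. *)
Lemma indep_systems_generated (G F : set (set T)) :
  G `<=` measurable -> F `<=` measurable -> setI_closed G -> G setT ->
  indep_systems P G F -> indep_systems P <<s G >> F.
Proof.
move=> mG mF GI GT GF A B sA FB.
have mB := mF _ FB.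
have PBfin : P B \is a fin_num by exact: fin_num_measure.
pose r : {nonneg R} := NngNum (fine_ge0 (measure_ge0 P B)).
have -> : P (A `&` B) = mrestr P mB A by [].
rewrite muleC -[X in (X * _)%E](fineK PBfin).
have -> : ((fine (P B))%:E * P A = mscale r P A)%E by [].
apply: (@g_sigma_algebra_measure_unique _ _ _ G mG (fun _ => setT)) => //.
- by rewrite bigcup_const//; exists 0%N.
- move=> C GC /=; rewrite /mrestr /mscale /= GF// muleC.
  by rewrite fineK.
- by move=> k; rewrite /= /mrestr -ge0_fin_numE//; apply: fin_num_measure;
    exact: measurableI.
Qed.

Lemma measurable_generated (G : set (set T)) d' (T' : measurableType d') (X : T -> T') :
  G `<=` measurable ->
  measurable_fun [set: g_sigma_algebraType G] (X : g_sigma_algebraType G -> T') ->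
  measurable_fun [set: T] X.
Proof.
move=> mG mX _ B mB; have := mX measurableT B mB.
by apply: (@smallest_sub _ _ _ _ _ mG); exact: sigma_algebra_measurable.
Qed.

(** If [D] is independent of the sigma-algebra generated by [G], the law of
    the pair (identity, [D]) on the product of that sigma-algebra with the
    Borel sets is a product measure, and Tonelli's theorem applies. *)
Lemma indep_expectationM (G : set (set T)) (X D : T -> R) (g : R -> R) :
  G `<=` measurable ->
  measurable_fun [set: g_sigma_algebraType G] (X : g_sigma_algebraType G -> R) ->
  measurable_fun setT D -> measurable_fun setT g ->
  (forall w, 0 <= X w) -> (forall z, 0 <= g z) ->
  indep_systems P <<s G >> (sigma_RV D) ->
  (\int[P]_w (X w * g (D w))%:E =
   \int[P]_w (X w)%:E * \int[P]_w (g (D w))%:E)%E.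
Proof.
move=> mG mX mD mg X0 g0 XD.
pose S := g_sigma_algebraType G.
have mid : measurable_fun [set: T] (id : T -> S).
  by move=> _ B mB; rewrite setTI; exact: (@smallest_sub _ _ _ _ (sigma_algebra_measurable _) mG).
pose i' : {mfun T >-> S} := mfun_Sub (mem_set mid).
pose D' : {mfun T >-> R} := mfun_Sub (mem_set mD).
pose m1 := distribution P i'; pose m2 := distribution P D'.
pose pr : T -> S * R := fun w => (w, D w).
have mpr : measurable_fun setT pr by exact: measurable_fun_pair.
pose pr' : {mfun T >-> (S * R)%type} := mfun_Sub (mem_set mpr).
pose m := distribution P pr'.
pose F (z : S * R) := (X z.1 * g z.2)%:E.
have mF : measurable_fun setT F.
  apply/measurable_EFinP; apply: measurable_funM.
    by apply: (measurableT_comp mX); exact: measurable_fst.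
  by apply: (measurableT_comp mg); exact: measurable_snd.
have F0 z : (0 <= F z)%E by rewrite lee_fin mulr_ge0.
transitivity (\int[m]_z F z)%E.
  by rewrite /m ge0_integral_pushforward.
transitivity (\int[(m1 \x m2)%E]_z F z)%E.
  apply: eq_measure_integral => A mA _; apply/esym.
  have := @product_measure_unique _ _ S R R m1 m2 m.
  apply => // B C mB mC; apply: XD => //.
  by exists C => //; rewrite setTI.
rewrite fubini_tonelli1//.
have -> : (\int[P]_w (g (D w))%:E = \int[m2]_y (g y)%:E)%E.
  rewrite /m2 ge0_integral_pushforward//; first exact/measurable_EFinP.
  by move=> y _; rewrite lee_fin.
have -> : (\int[P]_w (X w)%:E = \int[m1]_x (X x)%:E)%E.
  rewrite /m1 ge0_integral_pushforward//; first exact/measurable_EFinP.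
  by move=> y _; rewrite lee_fin.
rewrite -ge0_integralZr//; last 3 first.
- exact/measurable_EFinP.
- by move=> x _; rewrite lee_fin.
- by apply: integral_ge0 => y _; rewrite lee_fin.
apply: eq_integral => x _; rewrite /fubini_F/= /F/=.
rewrite -ge0_integralZl_EFin//; last 2 first.
- by move=> y _; rewrite lee_fin.
- exact/measurable_EFinP.
Qed.

Lemma eq_law_expectation (X Y : T -> R) (g : R -> R) :
  measurable_fun setT X -> measurable_fun setT Y -> measurable_fun setT g ->
  (forall z, 0 <= g z) ->
  (forall A, measurable A -> P (X @^-1` A) = P (Y @^-1` A)) ->
  (\int[P]_w (g (X w))%:E = \int[P]_w (g (Y w))%:E)%E.
Proof.
move=> mX mY mg g0 XY.
pose X' : {mfun T >-> R} := mfun_Sub (mem_set mX).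
pose Y' : {mfun T >-> R} := mfun_Sub (mem_set mY).
transitivity (\int[distribution P X']_y (g y)%:E)%E.
  rewrite ge0_integral_pushforward//; first exact/measurable_EFinP.
  by move=> y _; rewrite lee_fin.
transitivity (\int[distribution P Y']_y (g y)%:E)%E.
  by apply: eq_measure_integral => A mA _; exact: XY.
rewrite ge0_integral_pushforward//; first exact/measurable_EFinP.
by move=> y _; rewrite lee_fin.
Qed.

End Independence.

Section LevyPast.
Context {d : measure_display} {T : measurableType d} {R : realType}.
Context {P : probability T R}.
Variables (J : R -> {RV P >-> R}) (V : {RV P >-> R}).

(** Intersections rather than unions of the two kinds of events, so as to have
    a pi-system generating the information about [V] and about [J] up to [s]. *)
Definition past (s : R) : set (set T) :=
  [set C | exists A B, [/\ sigma_RV V A, sigma_process `[0, s] J B & C = A `&` B]].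

Lemma sigma_RV_preimage (X : T -> R) (A : set R) : measurable A ->
  sigma_RV X (X @^-1` A).
Proof. by move=> mA; exists A => //; rewrite setTI. Qed.

Lemma sigma_RVT (X : T -> R) : sigma_RV X setT.
Proof. by rewrite -(preimage_setT X); exact: sigma_RV_preimage. Qed.

Lemma sigma_RV_measurable (X : {RV P >-> R}) : sigma_RV X `<=` measurable.
Proof. by move=> _ [A mA <-]; exact: measurable_funP. Qed.

Lemma sigma_processT (I : set R) : sigma_process I J setT.
Proof.
have [s0 sC _] := smallest_sigma_algebra setT (\bigcup_(t in I) sigma_RV (J t)).
by have := sC _ s0; rewrite setD0.
Qed.

Lemma sigma_processI (I : set R) : setI_closed (sigma_process I J).
Proof. by move=> A B mA mB; exact: (@measurableI _ (g_sigma_algebraType (\bigcup_(t in I)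
  sigma_RV (J t)))). Qed.

Lemma sigma_process_measurable (I : set R) : sigma_process I J `<=` measurable.
Proof.
apply: smallest_sub; first exact: sigma_algebra_measurable.
by move=> A [t _]; exact: sigma_RV_measurable.
Qed.

Lemma sub_sigma_process (I I' : set R) : I `<=` I' ->
  sigma_process I J `<=` sigma_process I' J.
Proof. by move=> II'; apply: sub_smallest2r; [exact: smallest_sigma_algebra|move=> A [t It sA];
  exists t => //; exact: II']. Qed.

Lemma process_measurable (I : set R) t : I t ->
  measurable_fun [set: g_sigma_algebraType (\bigcup_(t in I) sigma_RV (J t))]
    (J t : g_sigma_algebraType (\bigcup_(t in I) sigma_RV (J t)) -> R).
Proof.
move=> It _ A mA; apply: sub_gen_smallest; exists t => //.
by exists A.
Qed.

Lemma past_measurable s : past s `<=` measurable.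
Proof.
move=> _ [A [B [sA sB ->]]]; apply: measurableI; first exact: sigma_RV_measurable sA.
exact: sigma_process_measurable sB.
Qed.

Lemma past_setI_closed s : setI_closed (past s).
Proof.
move=> _ _ [A [B [[A0 mA0 <-] sB ->]]] [A' [B' [[A1 mA1 <-] sB' ->]]].
exists (V @^-1` (A0 `&` A1)), (B `&` B'); split.
- by apply: sigma_RV_preimage; exact: measurableI.
- exact: sigma_processI.
- by rewrite !setTI preimage_setI setIACA.
Qed.

Lemma pastT s : past s setT.
Proof.
exists setT, setT; split; [exact: sigma_RVT|exact: sigma_processT|by rewrite setTI].
Qed.

Lemma past_V s : measurable_fun [set: g_sigma_algebraType (past s)]
  (V : g_sigma_algebraType (past s) -> R).
Proof.
move=> _ A mA; apply: sub_gen_smallest; rewrite setTI.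
exists (V @^-1` A), setT; split; last by rewrite setIT.
- exact: sigma_RV_preimage.
- exact: sigma_processT.
Qed.

Lemma past_J s u : 0 <= u <= s -> measurable_fun [set: g_sigma_algebraType (past s)]
  (J u : g_sigma_algebraType (past s) -> R).
Proof.
move=> us _ A mA; apply: sub_gen_smallest; rewrite setTI.
exists setT, (J u @^-1` A); split; last by rewrite setTI.
- exact: sigma_RVT.
- apply: sub_gen_smallest; exists u; first by rewrite /= in_itv.
  exact: sigma_RV_preimage.
Qed.

Hypothesis J_levy : levy_process J.
Hypothesis V_indep : indep_systems P (sigma_RV V) (sigma_process `[0, +oo[ J).

Lemma increment_measurable s t : measurable_fun setT (increment J s t).
Proof. exact: measurable_funB. Qed.

(** [V] is split off first, being independent of the whole process, and then
    the increment from the past of [J]. *)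
Lemma increment_indep_past s t : 0 <= s -> s <= t ->
  indep_systems P <<s past s>> (sigma_RV (increment J s t)).
Proof.
move=> s0 st; apply: indep_systems_generated.
- exact: past_measurable.
- by move=> _ [A mA <-]; exact: increment_measurable.
- exact: past_setI_closed.
- exact: pastT.
move=> _ C [A [B [sA sB ->]]] sC.
have sub : sigma_process `[0, s] J `<=` sigma_process `[0, +oo[ J.
  by apply: sub_sigma_process => u /=; rewrite !in_itv/= => /andP[->].
have sC' : sigma_process `[0, +oo[ J C.
  case: sC => D mD <-.
  have := @measurable_funB _ (g_sigma_algebraType (\bigcup_(t in `[0, +oo[) sigma_RV (J t)))
    R setT (J t) (J s).
  apply => //; apply: process_measurable; rewrite /= in_itv/= andbT//.
  exact: le_trans st.
rewrite -setIA V_indep//; last by apply: sigma_processI => //; exact: sub.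
rewrite [P (A `&` B)]V_indep//; last exact: sub.
rewrite -muleA; congr (_ * _)%E.
by rewrite setIC (levy_independent J_levy s0 st sC sB) muleC.
Qed.

Lemma increment_law s t (g : R -> R) : 0 <= s -> s <= t ->
  measurable_fun setT g -> (forall z, 0 <= g z) ->
  (\int[P]_w (g (increment J s t w))%:E = \int[P]_w (g (J (t - s) w))%:E)%E.
Proof.
move=> s0 st mg g0; apply: eq_law_expectation => //.
- exact: increment_measurable.
- by move=> A mA; rewrite levy_stationary.
Qed.

(** The form in which independence and stationarity of the increments are used
    below: an adapted factor separates from the next increment. *)
Lemma past_increment_expectation s t (X : T -> R) (g : R -> R) :
  0 <= s -> s <= t ->
  measurable_fun [set: g_sigma_algebraType (past s)] (X : g_sigma_algebraType (past s) -> R) ->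
  measurable_fun setT g -> (forall w, 0 <= X w) -> (forall z, 0 <= g z) ->
  (\int[P]_w (X w * g (increment J s t w))%:E =
   \int[P]_w (X w)%:E * \int[P]_w (g (J (t - s) w))%:E)%E.
Proof.
move=> s0 st mX mg X0 g0; rewrite -increment_law//.
apply: (indep_expectationM (G := past s)) => //.
- exact: past_measurable.
- exact: increment_measurable.
- exact: increment_indep_past.
Qed.

End LevyPast.

(** * Moments of small increments *)

Section BinomialCoefficients.
Context {R : realType}.

Definition signed_bin (N k : nat) : R := (-1) ^+ k * 'C(N, k)%:R.

Lemma pow_onem (x : R) N : (1 - x) ^+ N = \sum_(k < N.+1) signed_bin N k * x ^+ k.
Proof.
rewrite exprBn; apply: eq_bigr => k _.
by rewrite expr1n mulr1 -mulr_natr mulrAC.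
Qed.

Lemma sum_signed_bin N : (0 < N)%N -> \sum_(k < N.+1) signed_bin N k = 0.
Proof.
move=> N0; have := pow_onem 1 N; rewrite subrr expr0n gtn_eqF//= => E.
by rewrite [RHS]E; apply: eq_bigr => k _; rewrite expr1n mulr1.
Qed.

Lemma pow_onem_sub1 (x : R) N : (0 < N)%N ->
  (1 - x) ^+ N = \sum_(k < N.+1) signed_bin N k * (x ^+ k - 1).
Proof.
move=> N0; under eq_bigr do rewrite mulrBr mulr1.
by rewrite sumrB -pow_onem sum_signed_bin// subr0.
Qed.

(** Why drift and Gaussian part of a Laplace exponent do not contribute to the
    fourth moments below. *)
Lemma fourth_difference_quadratic (a b : R) :
  \sum_(k < 5) signed_bin 4 k * (a * k%:R + b * k%:R ^+ 2) = 0.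
Proof.
rewrite -(big_mkord predT (fun k => signed_bin 4 k * (a * k%:R + b * k%:R ^+ 2))).
rewrite /index_iota /= !big_cons big_nil /signed_bin.
have [-> -> -> -> ->] : [/\ 'C(4, 0) = 1, 'C(4, 1) = 4, 'C(4, 2) = 6, 'C(4, 3) = 4 &
  'C(4, 4) = 1]%N by [].
ring.
Qed.

Lemma expR_scaled_cvg (x : R) :
  2 ^+ n * (expR (- (x / 2 ^+ n)) - 1) @[n --> \oo] --> - x.
Proof.
have p n : 0 < 2 ^+ n :> R by exact: exprn_gt0.
have v0 : (2 ^- n : R) @[n --> \oo] --> 0 by exact: cvg_pow2V.
have xv : x * 2 ^- n @[n --> \oo] --> x * 0 by apply: cvgMr.
rewrite mulr0 in xv.
have xv1 : 1 + x * 2 ^- n @[n --> \oo] --> (1 + 0 : R).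
  by apply: cvgD => //; exact: cvg_cst.
have h : - x / (1 + x * 2 ^- n) @[n --> \oo] --> (- x / (1 + 0) : R).
  apply: cvgM; first exact: cvg_cst.
  by apply: cvgV => //; rewrite addr0 oner_neq0.
rewrite addr0 divr1 in h.
apply: (@squeeze_cvgr _ _ _ _ (cst (- x)) (fun n => - x / (1 + x * 2 ^- n))) => //;
  last exact: cvg_cst.
have /cvgrPdist_lt/(_ _ ltr01) := xv; apply: filterS => n.
rewrite sub0r normrN => xn.
have y0 : 0 < 1 + x * 2 ^- n by move: xn; rewrite ltr_norml => /andP[]; lra.
have y0' : 1 + x / 2 ^+ n != 0 by rewrite gt_eqF.
have q := p n; have q0 : 2 ^+ n != 0 :> R by rewrite gt_eqF.
apply/andP; split.
  have -> : cst (- x) n = 2 ^+ n * (- (x / 2 ^+ n)) by rewrite /=; field.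
  by rewrite ler_pM2l// lerBrDl expR_ge1Dx.
have -> : - x / (1 + x * 2 ^- n) = 2 ^+ n * ((1 + x / 2 ^+ n)^-1 - 1).
  by field; rewrite q0 /= -[X in X + x](mul1r (2 ^+ n)) -[X in _ + X](mulfVK q0) -mulrDl mulf_neq0.
by rewrite ler_pM2l// lerD2r expRN lef_pV2 ?posrE ?expR_gt0// expR_ge1Dx.
Qed.

End BinomialCoefficients.

Section LaplaceExponent.
Context {R : realType}.
Variables (c sigma : R) (nu : {measure set R -> \bar R}).
Hypothesis nu_jump : jump_measure nu.

Let D : set R := `]0, +oo[%classic.

Lemma measurable_expR_lin (a : R) : measurable_fun setT (fun y : R => expR (- a * y)).
Proof.
by apply: (measurableT_comp (@measurable_expR R)); exact: mulrl_measurable.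
Qed.

Lemma integrable_expR_sub1 (a : R) : 0 <= a ->
  nu.-integrable D (EFin \o (fun y => expR (- a * y) - 1)).
Proof.
move=> a0; pose g (y : R) := ((1 + a)%:E * (Num.min 1 y)%:E)%E.
have mD : measurable D by exact: measurable_itv.
apply: (le_integrable mD (g := g)).
- apply/measurable_EFinP; apply: measurable_funTS.
  by apply: measurable_funB => //; exact: measurable_expR_lin.
- move=> y; rewrite /D/= in_itv/= andbT => y0; rewrite lee_fin.
  rewrite ler0_norm ?opprB; last by rewrite subr_le0 -expR0 ler_expR mulNr oppr_le0 mulr_ge0// ltW.
  rewrite ger0_norm; last by rewrite mulr_ge0 ?addr_ge0// le_min ler01 ltW.
  have e0 : 0 < expR (- a * y) by exact: expR_gt0.
  have e1 : 1 + (- a * y) <= expR (- a * y) by exact: expR_ge1Dx.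
  by case: (leP 1 y) => y1; nra.
- apply: integrableZl; first exact: measurable_itv.
  apply/integrableP; split.
    apply/measurable_EFinP; apply: measurable_funTS.
    by apply: measurable_minr => //; exact: measurable_id.
  move: nu_jump; rewrite /jump_measure; congr (_ < _)%E.
  apply: eq_integral => y; rewrite inE /= in_itv/= andbT => y0.
  by rewrite ger0_norm// le_min ler01 ltW.
Qed.

Definition psi (a : R) : R := c * a - sigma ^+ 2 * a ^+ 2 / 2 -
  \int[nu]_(y in D) (expR (- a * y) - 1).

Lemma levy_exponentE a : 0 <= a -> levy_exponent c sigma nu a = (psi a)%:E.
Proof.
move=> a0; rewrite /levy_exponent /psi [RHS]EFinB; congr (_ - _)%E.
rewrite /Rintegral fineK//.
exact: (integrable_fin_num (measurable_itv _) (integrable_expR_sub1 a0)).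
Qed.

(** Fourth differences at [0, m, 2 m, 3 m, 4 m] turn the integrand of the
    exponent into [(1 - exp (- m y)) ^ 4] and kill the drift and the Gaussian
    term. *)
Lemma fourth_difference_psi (m : R) : 0 <= m ->
  (\int[nu]_(y in `]0%R, +oo[) ((1 - expR (- m * y)) ^+ 4)%:E)%E =
  (\sum_(k < 5) signed_bin 4 k * - psi (k%:R * m))%:E.
Proof.
move=> m0.
have km (k : nat) : 0 <= k%:R * m by rewrite mulr_ge0.
pose h (k : nat) (y : R) : \bar R := ((signed_bin 4 k)%:E * (expR (- (k%:R * m) * y) - 1)%:E)%E.
have ih k : nu.-integrable D (h k).
  by apply: integrableZl; [exact: measurable_itv|exact: integrable_expR_sub1].
have -> : (\int[nu]_(y in `]0%R, +oo[) ((1 - expR (- m * y)) ^+ 4)%:E)%E =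
    (\int[nu]_(y in D) (\sum_(k < 5) h k y)%R)%E.
  apply: eq_integral => y _; rewrite /h pow_onem_sub1// -sumEFin.
  apply: eq_bigr => k _; rewrite -EFinM; congr (_ * (_ - _))%:E.
  by rewrite -expRM_natl; congr expR; ring.
rewrite integral_sum//; last exact: measurable_itv.
have E (k : nat) : (\int[nu]_(y in D) h k y)%E =
    (signed_bin 4 k * \int[nu]_(y in D) (expR (- (k%:R * m) * y) - 1))%:E.
  rewrite /h integralZl//; [|exact: measurable_itv|exact: integrable_expR_sub1].
  rewrite [RHS]EFinM [in RHS]/Rintegral fineK//.
  exact: (integrable_fin_num (measurable_itv _) (integrable_expR_sub1 (km k))).
under eq_bigr do rewrite E.
rewrite sumEFin; congr _%:E; apply/eqP; rewrite -subr_eq0 -sumrB; apply/eqP.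
rewrite -[RHS](fourth_difference_quadratic (c * m) (- (sigma ^+ 2 * m ^+ 2 / 2))).
by apply: eq_bigr => k _; rewrite /psi; ring.
Qed.

End LaplaceExponent.

Section LevyMoments.
Context {d : measure_display} {T : measurableType d} {R : realType}.
Context {P : probability T R}.
Variables (J : R -> {RV P >-> R}) (V : {RV P >-> R}).
Variables (c sigma : R) (nu : {measure set R -> \bar R}).
Hypothesis J_levy : levy_process J.
Hypothesis V_indep : indep_systems P (sigma_RV V) (sigma_process `[0, +oo[ J).
Hypothesis nu_jump : jump_measure nu.
Hypothesis J_exponent : forall a : R, 0 <= a ->
  laplace_exponent J a = levy_exponent c sigma nu a.

Let psi := psi c sigma nu.

(** Halving the time takes the square root of the transform. *)
Lemma laplace_dyadic n (a : R) : 0 <= a ->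
  (\int[P]_w (expR (- a * J (2 ^- n) w))%:E)%E = (expR (- (psi a / 2 ^+ n)))%:E.
Proof.
move=> a0; elim: n => [|n ih].
  have := J_exponent a0; rewrite levy_exponentE// /laplace_exponent unlock.
  rewrite expr0 invr1 mulr1 -/(psi a).
  set I := (\int[P]_w _)%E; rewrite -/I; have : (0 <= I)%E.
    by apply: integral_ge0 => w _; rewrite lee_fin expR_ge0.
  case: I => [r| |]//= r0; case: ifPn => //; rewrite -ltNge => {}r0 [lnr].
  by rewrite -lnr opprK lnK.
set h : R := 2 ^- n.+1; have h0 : 0 < h by rewrite invr_gt0.
have hh : 2 ^- n = h + h.
  by rewrite /h exprS; field; rewrite gt_eqF.
have mg : measurable_fun setT (fun y : R => expR (- a * y)) by exact: measurable_expR_lin.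
have E : (\int[P]_w (expR (- a * J (2 ^- n) w))%:E =
    \int[P]_w (expR (- a * J h w))%:E *
    \int[P]_w (expR (- a * J (h + h - h)%R w))%:E)%E.
  rewrite -(past_increment_expectation J_levy V_indep (s := h) (t := h + h)
    (X := fun w => expR (- a * J h w)) (g := fun z => expR (- a * z)))//.
  - by apply: eq_integral => w _; rewrite -expRD hh /increment; congr (expR _)%:E; ring.
  - exact: ltW.
  - by rewrite lerDl ltW.
  - by apply: (measurableT_comp mg); apply: past_J; rewrite lexx ltW.
move: E; rewrite addrK ih; set I := (\int[P]_w _)%E; rewrite -/I; have : (0 <= I)%E.
  by apply: integral_ge0 => w _; rewrite lee_fin expR_ge0.
case: I => [r| |]//= r0 E.
move: E => /eqP; rewrite -EFinM eqe => /eqP E; congr _%:E.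
apply: (@pexpIrn _ 2) => //; rewrite ?nnegrE ?expR_ge0//.
rewrite expr2 -E -expRM_natl; congr expR.
by rewrite hh; ring.
Qed.

Definition moment N m n : R :=
  \sum_(k < N.+1) signed_bin N k * expR (- (psi (k%:R * m) / 2 ^+ n)).

(** Expanding the power gives Laplace transforms. Since the coefficients of the
    expansion add up to [0], the moments are of the order of the time step,
    as [moment_cvg] makes precise. *)
Lemma momentE N (m : R) n : 0 <= m ->
  (\int[P]_w ((1 - expR (- m * J (2 ^- n) w)) ^+ N)%:E)%E = (moment N m n)%:E.
Proof.
move=> m0.
have km (k : nat) : 0 <= k%:R * m by rewrite mulr_ge0.
pose e (k : nat) (w : T) : \bar R := (expR (- (k%:R * m) * J (2 ^- n) w))%:E.
have ie k : P.-integrable setT (e k).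
  apply/integrableP; split.
    apply/measurable_EFinP; apply: (measurableT_comp (measurable_expR_lin (k%:R * m))).
    exact: measurable_funPT.
  under eq_integral do rewrite /e gee0_abs ?lee_fin ?expR_ge0//.
  by rewrite laplace_dyadic// ltry.
pose h (k : nat) (w : T) : \bar R := ((signed_bin N k)%:E * e k w)%E.
have ih k : P.-integrable setT (h k) by exact: integrableZl.
transitivity (\int[P]_w (\sum_(k < N.+1) h k w)%R)%E.
  apply: eq_integral => w _; rewrite /h pow_onem -sumEFin.
  apply: eq_bigr => k _; rewrite -EFinM; congr (_ * _)%:E.
  by rewrite -expRM_natl; congr expR; ring.
rewrite integral_sum// /moment -sumEFin; apply: eq_bigr => k _.
by rewrite /h integralZl// laplace_dyadic// EFinM.
Qed.

Lemma moment_cvg N m : (0 < N)%N ->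
  2 ^+ n * moment N m n @[n --> \oo] -->
  \sum_(k < N.+1) signed_bin N k * - psi (k%:R * m).
Proof.
move=> N0.
have E n : 2 ^+ n * moment N m n = \sum_(k <- index_enum 'I_N.+1)
    signed_bin N k * (2 ^+ n * (expR (- (psi (k%:R * m) / 2 ^+ n)) - 1)).
  under eq_bigr do rewrite mulrCA mulrBr mulr1.
  by rewrite -mulr_sumr sumrB sum_signed_bin// subr0.
under eq_fun do rewrite E.
apply: (@cvg_big_seq R 'I_N.+1) => k _; apply: cvgMr; exact: expR_scaled_cvg.
Qed.

(** The increments over the cells of the grid are i.i.d. *)
Lemma grid_sum_moments (g : R -> R) (n K : nat) (e1 e2 : R) :
  measurable_fun setT g -> (forall z, 0 <= g z) ->
  (\int[P]_w (g (J (2 ^- n) w))%:E = e1%:E)%E ->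
  (\int[P]_w (g (J (2 ^- n) w) ^+ 2)%:E = e2%:E)%E ->
  (\int[P]_w (\sum_(k < K) g (increment J (grid n k) (grid n k.+1) w))%:E =
     (K%:R * e1)%:E)%E /\
  (\int[P]_w ((\sum_(k < K) g (increment J (grid n k) (grid n k.+1) w)) ^+ 2)%:E =
     (K%:R * e2 + (K%:R ^+ 2 - K%:R) * e1 ^+ 2)%:E)%E.
Proof.
move=> mg g0 E1 E2; elim: K => [|K [ih1 ih2]].
  split; rewrite (eq_integral (cst 0%E)) ?integral0 ?mul0r//=.
  - by move=> w _; rewrite big_ord0.
  - by rewrite expr0n/= subrr mul0r addr0.
  - by move=> w _; rewrite big_ord0 expr0n.
pose S w := \sum_(k < K) g (increment J (grid n k) (grid n k.+1) w).
pose G w := g (increment J (grid n K) (grid n K.+1) w).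
have S0 w : 0 <= S w by exact: sumr_ge0.
have mS' : measurable_fun [set: g_sigma_algebraType (past J V (grid n K))]
    (S : g_sigma_algebraType (past J V (grid n K)) -> R).
  apply: measurable_sum => k; apply: (measurableT_comp mg).
  apply: measurable_funB; apply: past_J; rewrite grid_ge0/=; apply: le_grid => //.
  exact: ltnW.
have mS : measurable_fun setT S.
  by apply: measurable_generated mS'; exact: past_measurable.
have mG : measurable_fun setT G.
  by apply: (measurableT_comp mg); exact: increment_measurable.
have gridB : grid n K.+1 - grid n K = 2 ^- n :> R by rewrite gridS addrAC subrr add0r.
have le_g : grid n K <= grid n K.+1 :> R by exact: le_grid.
have E1' : (\int[P]_w (G w)%:E = e1%:E)%E.
  by rewrite /G (increment_law J_levy)// ?grid_ge0// gridB.
have mg2 : measurable_fun setT (fun z => g z ^+ 2) by exact: measurable_funX.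
have E2' : (\int[P]_w (G w ^+ 2)%:E = e2%:E)%E.
  by rewrite /G (increment_law J_levy (g := fun z => g z ^+ 2))// ?grid_ge0// ?gridB// => z;
    exact: sqr_ge0.
have E12 : (\int[P]_w (S w * G w)%:E = (K%:R * e1 * e1)%:E)%E.
  by rewrite (past_increment_expectation J_levy V_indep)// ?grid_ge0// gridB E1 -/(S _) ih1 EFinM.
split.
  under eq_integral do rewrite big_ord_recr/= EFinD.
  rewrite ge0_integralD//.
  - by rewrite ih1 E1' -EFinD -natr1; congr _%:E; ring.
  - by move=> w _; rewrite lee_fin; exact: S0.
  - exact/measurable_EFinP.
  - by move=> w _; rewrite lee_fin.
  - exact/measurable_EFinP.
transitivity (\int[P]_w ((S w ^+ 2)%:E + (2%:E * (S w * G w)%:E + (G w ^+ 2)%:E)))%E.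
  apply: eq_integral => w _; rewrite big_ord_recr/= -/(S w) -/(G w) -!EFinM -!EFinD.
  by congr _%:E; ring.
have mSG : measurable_fun setT (fun w => S w * G w) by exact: measurable_funM.
have mS2 : measurable_fun setT (fun w => S w ^+ 2) by exact: measurable_funX.
have mG2 : measurable_fun setT (fun w => G w ^+ 2) by exact: measurable_funX.
have mSGe : measurable_fun setT (fun w => (2%:E * (S w * G w)%:E)%E).
  apply: (measurable_EFinP _ (fun w => 2 * (S w * G w))).2.
  exact: (measurable_funM (measurable_cst _) mSG).
have SG0 w : 0 <= S w * G w by exact: mulr_ge0 (S0 w) (g0 _).
rewrite ge0_integralD//; last 4 first.
- by move=> w _; rewrite lee_fin sqr_ge0.
- exact/measurable_EFinP.
- by move=> w _; rewrite lee_fin addr_ge0 ?sqr_ge0// mulr_ge0.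
- by apply: emeasurable_funD => //; exact/measurable_EFinP.
rewrite ge0_integralD//; last 3 first.
- by move=> w _; rewrite lee_fin mulr_ge0.
- by move=> w _; rewrite lee_fin sqr_ge0.
- exact/measurable_EFinP.
rewrite ge0_integralZl_EFin//; last 2 first.
- by move=> w _; rewrite lee_fin.
- exact/measurable_EFinP.
by rewrite ih2 E12 E2' -EFinM -!EFinD -natr1; congr _%:E; ring.
Qed.

End LevyMoments.

(** * Limits of grid sums *)

Section JumpSumLimit.
Context {d : measure_display} {T : measurableType d} {R : realType}.
Context {P : probability T R}.
Variables (J : R -> {RV P >-> R}) (V : {RV P >-> R}).
Variables (c sigma : R) (nu : {measure set R -> \bar R}).
Hypothesis J_levy : levy_process J.
Hypothesis V_indep : indep_systems P (sigma_RV V) (sigma_process `[0, +oo[ J).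
Hypothesis nu_jump : jump_measure nu.
Hypothesis J_exponent : forall a : R, 0 <= a ->
  laplace_exponent J a = levy_exponent c sigma nu a.

(** The exponent is at least [3] in order to see neither drift nor Gaussian
    part, and even in order to be nonnegative for increments of either sign. *)
Definition quartic (m z : R) : R := (1 - expR (- m * z)) ^+ 4.

Lemma quartic_ge0 m z : 0 <= quartic m z.
Proof. by rewrite /quartic (_ : 4 = 2 * 2)%N// exprM sqr_ge0. Qed.

Lemma continuous_quartic m : continuous (quartic m).
Proof.
move=> z; rewrite /quartic.
have h : 1 - expR (- m * x) @[x --> z] --> 1 - expR (- m * z).
  apply: cvgB; first exact: cvg_cst.
  apply: (@continuous_cvg _ _ _ _ _ _ expR); first exact: continuous_expR.
  by apply: cvgMr; exact: cvg_id.
by apply: (@continuous_cvg _ _ _ _ _ _ (fun x : R => x ^+ 4)); [exact: exprn_continuous|].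
Qed.

Lemma measurable_quartic m : measurable_fun setT (quartic m).
Proof. exact: continuous_measurable_fun (@continuous_quartic m). Qed.

Lemma cvg_seq_le (u : nat -> R) (l : R) : u n @[n --> \oo] --> l ->
  exists C : R, forall n, u n <= C.
Proof.
move=> ul; have /cvg_seq_bounded[K [_ /(_ (K + 1))]] : cvgn u by apply/cvg_ex; exists l.
by rewrite ltrDl ltr01 => /(_ isT) uK; exists (K + 1) => n; apply: le_trans (ler_norm _) (uK n I).
Qed.

(** The sums over the grid converge pathwise, and their second moments are
    bounded because those of the sums for [quartic m] are; so the expectations
    converge as well. At each step of the grid the expectation factorizes, the
    increment being independent of the past. *)
Lemma jump_sum_limit (m e : R) (phi : R -> R) (X : nat -> nat -> T -> R)
    (y : T -> R -> R) (M : nat) :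
  0 <= m -> 0 < e -> (forall z, `|z| <= e -> phi z = 0) -> continuous phi ->
  (forall z, 0 <= phi z <= quartic m z) ->
  (forall n k, measurable_fun [set: g_sigma_algebraType (past J V (grid n k))]
     (X n k : g_sigma_algebraType (past J V (grid n k)) -> R)) ->
  (forall n k w, 0 <= X n k w <= 1) ->
  (forall w u, 0 < u -> u <= M%:R -> X n (cell n u) w @[n --> \oo] --> y w u) ->
  let D w := \esum_(u in `]0, M%:R]) (y w u * phi (jump (J^~ w) u))%:E in
  [/\ measurable_fun setT D, forall w, D w \is a fin_num,
     (\int[P]_w D w < +oo)%E &
     ((\int[P]_w (\sum_(k < M * 2 ^ n) X n k w)%:E) *
        \int[P]_w (phi (J (2 ^- n) w))%:E)%E @[n --> \oo] --> (\int[P]_w D w)%E].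
Proof.
move=> m0 e0 phi0 cphi phib mX Xb Xy D.
pose Y n w := \sum_(k < M * 2 ^ n) X n k w * phi (increment J (grid n k) (grid n k.+1) w).
have cw w : cadlag (J^~ w) by exact: levy_cadlag.
have phi_ge0 z : 0 <= phi z by have /andP[] := phib z.
have X0 n k w : 0 <= X n k w by have /andP[] := Xb n k w.
have y0 w u : 0 < u <= M%:R -> 0 <= y w u.
  move=> /andP[u0 uM]; rewrite -(cvg_lim (@Rhausdorff R) (Xy w u u0 uM)).
  apply: limr_ge; last exact: nearW.
  by apply/cvg_ex; exists (y w u); exact: Xy.
have lim w : exists l : R, D w = l%:E /\ Y n w @[n --> \oo] --> l.
  exact: (grid_sum_cvg_esum (X := fun n k => X n k w) (cw w) e0 phi0 cphi phi_ge0
    (y0 w) (Xy w)).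
pose Z w := fine (D w).
have DZ w : D w = (Z w)%:E by have [l [Dl _]] := lim w; rewrite /Z Dl.
have YZ w : Y n w @[n --> \oo] --> Z w by have [l [Dl +]] := lim w; rewrite /Z Dl.
have mphi : measurable_fun setT phi by exact: continuous_measurable_fun.
have mX' n k : measurable_fun setT (X n k).
  by apply: measurable_generated (mX n k); exact: past_measurable.
have mi n k : measurable_fun setT (fun w => phi (increment J (grid n k) (grid n k.+1) w)).
  by apply: (measurableT_comp mphi); exact: increment_measurable.
have mY n : measurable_fun setT (Y n).
  by apply: measurable_sum => k; exact: measurable_funM.
have Y0 n w : 0 <= Y n w by apply: sumr_ge0 => k _; exact: mulr_ge0.
have [C1 C1P] := cvg_seq_le (@moment_cvg _ c sigma nu 4 m isT).
have [C2 C2P] := cvg_seq_le (@moment_cvg _ c sigma nu 8 m isT).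
have YC n : (\int[P]_w (Y n w ^+ 2)%:E <= (M%:R * C2 + (M%:R * C1) ^+ 2)%:E)%E.
  have q0 z : 0 <= quartic m z by exact: quartic_ge0.
  have E1 : (\int[P]_w (quartic m (J (2 ^- n) w))%:E = (moment c sigma nu 4 m n)%:E)%E.
    exact: (momentE J_levy V_indep).
  have E2 : (\int[P]_w (quartic m (J (2 ^- n) w) ^+ 2)%:E = (moment c sigma nu 8 m n)%:E)%E.
    rewrite -(momentE J_levy V_indep nu_jump J_exponent)//.
    by apply: eq_integral => w _; rewrite /quartic -exprM.
  have [_] := grid_sum_moments J_levy V_indep (M * 2 ^ n) (measurable_quartic m) q0 E1 E2.
  set S2 := (\int[P]_w _)%E => S2E.
  have YS : (\int[P]_w (Y n w ^+ 2)%:E <= S2)%E.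
    apply: ge0_le_integral => //.
    - by move=> w _; rewrite lee_fin sqr_ge0.
    - by apply/measurable_EFinP; exact: measurable_funX.
    - apply/measurable_EFinP; apply: measurable_funX; apply: measurable_sum => k.
      apply: (measurableT_comp (measurable_quartic m)); exact: increment_measurable.
    - move=> w _; rewrite lee_fin ler_sqr ?nnegrE//; last exact: sumr_ge0.
      apply: ler_sum => k _; have /andP[x0 x1] := Xb n k w.
      rewrite -[leRHS]mul1r ler_pM//.
      by have /andP[] := phib (increment J (grid n k) (grid n k.+1) w).
  apply: (le_trans YS); rewrite S2E lee_fin natrM natrX.
  have e10 : 0 <= moment c sigma nu 4 m n.
    by rewrite -lee_fin -E1; apply: integral_ge0 => w _; rewrite lee_fin.
  have p := pow2_gt0 (R := R) n.
  apply: lerD; first by rewrite -mulrA ler_wpM2l.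
  apply: (@le_trans _ _ ((M%:R * (2 ^+ n * moment c sigma nu 4 m n)) ^+ 2)).
    rewrite mulrA [leRHS]exprMn ler_wpM2r ?sqr_ge0//.
    by rewrite gerBl mulr_ge0// ltW.
  by rewrite ler_sqr ?nnegrE ?ler_wpM2l// !mulr_ge0// ?(ltW p)// (le_trans _ (C1P n))//
    mulr_ge0// ltW.
have [ZC EYZ] := cvg_expectation_second_moment mY Y0 YZ YC.
have ED : D = EFin \o Z by apply/funext => w; rewrite DZ.
split.
- rewrite ED; apply/measurable_EFinP; exact: (measurable_fun_cvg (h := Y)).
- by move=> w; rewrite DZ.
- by rewrite ED.
- rewrite ED; suff -> : (fun n : nat =>
      ((\int[P]_w (\sum_(k < M * 2 ^ n) X n k w)%:E) *
        \int[P]_w (phi (J (2 ^- n) w))%:E)%E) = (fun n => (\int[P]_w (Y n w)%:E)%E) by [].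
  apply/funext => n; under eq_integral do rewrite -sumEFin.
  under [RHS]eq_integral do rewrite /Y -sumEFin.
  rewrite ge0_integral_sum//; last 2 first.
  + by move=> k; exact/measurable_EFinP.
  + by move=> k w _; rewrite lee_fin.
  rewrite ge0_integral_sum//; last 2 first.
  + by move=> k; apply/measurable_EFinP; exact: measurable_funM.
  + by move=> k w _; rewrite lee_fin mulr_ge0.
  rewrite ge0_sume_distrl; last first.
    by move=> k _; apply: integral_ge0 => w _; rewrite lee_fin.
  apply: eq_bigr => k _.
  have gridB : grid n k.+1 - grid n k = 2 ^- n :> R by rewrite gridS addrAC subrr add0r.
  rewrite -gridB (past_increment_expectation J_levy V_indep)//; first exact: grid_ge0.
  exact: le_grid.
Qed.

End JumpSumLimit.

(** * Killing at level 0 *)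

Section Killing.
Context {R : realType}.
Implicit Types (w f : R -> R) (t u : R).

(** The uniform bound, stronger than positivity at all times up to [t], also
    excludes paths whose left limits reach [0]. *)
Definition alive w t := exists i : nat, forall r, 0 <= r -> r <= t -> i.+1%:R^-1 <= w r.

(** The times up to and including the first one at which the path or its left
    limit reaches [0]. Whether a time belongs to it depends on strictly earlier
    times only: the horizon is predictable. *)
Definition horizon w u := forall v, 0 <= v -> v < u -> alive w v.

Definition alive_ind w t : R := (`[< alive w t >])%:R.
Definition horizon_ind w u : R := (`[< horizon w u >])%:R.

Lemma alive_le w s t : s <= t -> alive w t -> alive w s.
Proof. by move=> st [i wi]; exists i => r r0 rs; apply: wi => //; exact: le_trans st. Qed.

Lemma alive_gt0 w t : 0 <= t -> alive w t -> 0 < w t.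
Proof. by move=> t0 [i wi]; apply: lt_le_trans (wi t t0 (lexx t)); rewrite invr_gt0. Qed.

Lemma alive_indP w t : 0 <= alive_ind w t <= 1.
Proof. by rewrite /alive_ind ler0n lern1; case: (asbool _). Qed.

Lemma inv_succ_le (x : R) : 0 < x -> exists i : nat, i.+1%:R^-1 <= x.
Proof.
move=> x0; exists (Num.trunc x^-1).
have /andP[_ xl] := truncn_itv (ltW (etrans (invr_gt0 x) x0 : 0 < x^-1)).
by rewrite -[leRHS]invrK lef_pV2 ?posrE ?invr_gt0// ltW.
Qed.

Lemma alive_near_right w t : cadlag w -> 0 <= t -> alive w t ->
  \forall x \near t^'+, alive w x.
Proof.
move=> cw t0 at_; have wt0 := alive_gt0 t0 at_; have [i wi] := at_.
have [j wj] : exists j : nat, j.+1%:R^-1 <= w t / 2 by apply: inv_succ_le; rewrite divr_gt0.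
have /cvgrPdist_lt/(_ (w t / 2)) := cw.1 t t0.
rewrite divr_gt0// => /(_ isT)/near_at_right_ball[r r0 wr].
have H : \forall x \near t^'+, x < t + r by apply: nbhs_right_lt; rewrite ltrDl.
have H' : \forall x \near t^'+, t < x by exact: nbhs_right_gt.
apply: filterS2 H H' => x xr tx; exists (maxn i j) => s s0 sx.
have [st|ts] := leP s t.
  apply: le_trans (wi s s0 st).
  by rewrite lef_pV2 ?posrE// ler_nat ltnS leq_maxl.
apply: (@le_trans _ _ (w t / 2)).
  by apply: le_trans wj; rewrite lef_pV2 ?posrE// ler_nat ltnS leq_maxr.
have := wr s ts (le_lt_trans sx xr); rewrite ltr_norml => /andP[_].
by rewrite ltrBlDr -ltrBlDl => /ltW; apply: le_trans; lra.
Qed.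

Lemma cvg_alive_ind_right w t : cadlag w -> 0 <= t ->
  alive_ind w x @[x --> t^'+] --> alive_ind w t.
Proof.
move=> cw t0; have [at_|nat_] := pselect (alive w t).
  apply: cvg_near_cst; apply: filterS (alive_near_right cw t0 at_) => x ax.
  by rewrite /alive_ind !asboolT.
apply: cvg_near_cst.
have H' : \forall x \near t^'+, t < x by exact: nbhs_right_gt.
apply: filterS H' => x tx; rewrite /alive_ind !asboolF//.
by move=> /(alive_le (ltW tx)).
Qed.

Lemma cvg_alive_ind_grid w u : 0 < u ->
  alive_ind w (grid n (cell n u)) @[n --> \oo] --> horizon_ind w u.
Proof.
move=> u0; apply: cvg_near_cst; have [hu|nhu] := pselect (horizon w u).
  apply: nearW => n; rewrite /alive_ind /horizon_ind !asboolT//.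
  by apply: hu; [exact: grid_ge0|have /andP[] := grid_cell n u0].
have [v [v0 vu nv]] : exists v, [/\ 0 <= v, v < u & ~ alive w v].
  apply: contrapT => H; apply: nhu => v v0 vu; apply: contrapT => nv.
  by apply: H; exists v.
have uv : 0 < u - v by rewrite subr_gt0.
have /cvgrPdist_lt/(_ _ uv) := cvg_grid_cell u0; apply: filterS => n gn.
rewrite /alive_ind /horizon_ind !asboolF// => /alive_le h; apply: nv; apply: h.
by move: gn; rewrite ltr_norml => /andP[_]; lra.
Qed.

(** Countably many times suffice, which makes being alive an event of the
    past. *)
Lemma alive_gridP w n k : cadlag w ->
  alive w (grid n k) <-> exists i : nat, forall l j : nat,
    grid l j <= grid n k :> R -> i.+1%:R^-1 <= w (grid l j).
Proof.
move=> cw; split => -[i wi]; exists i.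
  by move=> l j lj; apply: wi => //; exact: grid_ge0.
move=> r; rewrite le_eqVlt => /predU1P[<- _|r0 rt].
  have -> : 0 = grid 0 0 :> R by rewrite /grid mul0r.
  by apply: wi; rewrite {1}/grid mul0r grid_ge0.
move: rt; rewrite le_eqVlt => /predU1P[->|rt]; first exact: wi.
have cr := cvg_right_grid cw r0.
rewrite -(cvg_lim (@Rhausdorff R) cr); apply: limr_ge; first by apply/cvg_ex; exists (w r).
have tr : 0 < grid n k - r by rewrite subr_gt0.
have /cvgrPdist_lt/(_ _ tr) := cvg_grid_cellS r0; apply: filterS => l gn.
by apply: wi; move: gn; rewrite ltr_norml => /andP[+ _]; lra.
Qed.

End Killing.

Section ShiftedPath.
Context {R : realType}.
Variables (w : R -> R) (v : R).
Hypothesis cw : cadlag w.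

Lemma cadlag_shift : cadlag (fun t => v + w t).
Proof.
split=> t t0; first by apply: cvgD; [exact: cvg_cst|exact: cw.1].
apply/cvg_ex; exists (v + left_limit w t); apply: cvgD; first exact: cvg_cst.
exact: left_limitP.
Qed.

Lemma left_limit_shift u : 0 < u ->
  left_limit (fun t => v + w t) u = v + left_limit w u.
Proof.
move=> u0; have h := left_limitP cadlag_shift u0.
have h' : v + w x @[x --> u^'-] --> v + left_limit w u.
  by apply: cvgD; [exact: cvg_cst|exact: left_limitP].
by rewrite -(cvg_lim (@Rhausdorff R) h) (cvg_lim (@Rhausdorff R) h').
Qed.

Lemma jump_shift u : 0 < u -> jump (fun t => v + w t) u = jump w u.
Proof. by move=> u0; rewrite /jump left_limit_shift//; ring. Qed.

End ShiftedPath.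

(** * The identity for continuous functions *)

Section KilledFunctionals.
Context {R : realType}.

(** The functionals of the theorem with a bounded horizon and, for the jumps, a
    weight that makes the expectation finite. *)
Definition jump_sum (f phi : R -> R) (M : nat) (w : R -> R) : \bar R :=
  \esum_(u in `]0, M%:R]) (f (left_limit w u) * horizon_ind w u * phi (jump w u))%:E.

Definition area (f : R -> R) (M : nat) (w : R -> R) : \bar R :=
  (\int[lebesgue_measure]_(t in `]0%R, M%:R%R]) (f (w t) * alive_ind w t)%:E)%E.

End KilledFunctionals.

Section ContinuousCase.
Context {d : measure_display} {T : measurableType d} {R : realType}.
Context {P : probability T R}.
Variables (J : R -> {RV P >-> R}) (V : {RV P >-> R}).
Variables (c sigma : R) (nu : {measure set R -> \bar R}).
Hypothesis J_levy : levy_process J.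
Hypothesis V_indep : indep_systems P (sigma_RV V) (sigma_process `[0, +oo[ J).
Hypothesis nu_jump : jump_measure nu.
Hypothesis J_exponent : forall a : R, 0 <= a ->
  laplace_exponent J a = levy_exponent c sigma nu a.

Definition level (w : T) (t : R) : R := V w + J t w.

Lemma cadlag_level w : cadlag (level w).
Proof. by apply: cadlag_shift; exact: levy_cadlag. Qed.

Lemma past_level s u : 0 <= u <= s ->
  measurable_fun [set: g_sigma_algebraType (past J V s)]
    (fun w : g_sigma_algebraType (past J V s) => level w u).
Proof. by move=> us; apply: measurable_funD; [exact: past_V|exact: past_J]. Qed.

Lemma past_alive_ind n k :
  measurable_fun [set: g_sigma_algebraType (past J V (grid n k))]
    (fun w : g_sigma_algebraType (past J V (grid n k)) => alive_ind (level w) (grid n k)).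
Proof.
pose S := g_sigma_algebraType (past J V (grid n k)).
pose A (i l j : nat) : set S :=
  [set w : S | grid l j <= grid n k :> R -> i.+1%:R^-1 <= level w (grid l j)].
have mA i l j : measurable (A i l j).
  have [lj|lj] := boolP (grid l j <= grid n k :> R); last first.
    rewrite (_ : A i l j = setT)//; apply/seteqP; split => // w _.
    by rewrite /A /= (negbTE lj).
  have := @past_level (grid n k) (grid l j); rewrite grid_ge0 lj => /(_ isT).
  move=> /(_ measurableT `[i.+1%:R^-1, +oo[%classic (measurable_itv _)).
  rewrite setTI; congr (measurable _); apply/seteqP; split => w.
    by rewrite /A /= in_itv/= andbT.
  by rewrite /A /= in_itv/= andbT => /(_ lj).
pose B : set S := \bigcup_i \bigcap_l \bigcap_j A i l j.
have mB : measurable B.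
  apply: bigcup_measurable => i _; apply: bigcap_measurable => // l _.
  exact: bigcap_measurable.
rewrite (_ : (fun w => _) = \1_B); first exact: measurable_indic.
apply/funext => w; rewrite indicE /alive_ind; congr (_%:R); congr nat_of_bool.
apply/asboolP/idP; rewrite inE.
  move=> /(alive_gridP n k (cadlag_level w))[i wi]; exists i => // l _ j _ /=.
  exact: wi.
move=> [i _ wi]; apply/(alive_gridP n k (cadlag_level w)); exists i => l j lj.
exact: (wi l I j I).
Qed.

(** Tends to [lambda] as [phi] increases to the indicator of the positive
    numbers. *)
Definition jump_intensity (phi : R -> R) : \bar R :=
  (\int[P]_w (\esum_(u in `]0, 1]) (phi (jump (J^~ w) u))%:E)%R)%E.

Variables (m e : R) (phi : R -> R).
Hypothesis m0 : 0 <= m.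
Hypothesis e0 : 0 < e.
Hypothesis phi0 : forall z, `|z| <= e -> phi z = 0.
Hypothesis cphi : continuous phi.
Hypothesis phib : forall z, 0 <= phi z <= quartic m z.

(** The case of a constant factor and of the unit interval. *)
Lemma jump_intensity_cvg :
  (jump_intensity phi < +oo)%E /\
  ((2 ^+ n)%:E * \int[P]_w (phi (J (2 ^- n) w))%:E)%E @[n --> \oo] --> jump_intensity phi.
Proof.
have [] := jump_sum_limit J_levy V_indep nu_jump J_exponent m0 e0 phi0 cphi phib
  (X := fun _ _ _ => 1) (y := fun _ _ => 1) (M := 1).
- by move=> n k; exact: measurable_cst.
- by move=> n k w; rewrite ler01 lexx.
- by move=> w u _ _; exact: cvg_cst.
move=> _ _; have -> : (fun w => \esum_(u in `]0, 1%:R])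
    (1 * phi (jump (fun x : R => J x w) u))%:E) =
    (fun w => \esum_(u in `]0, 1]) (phi (jump (J^~ w) u))%:E).
  by apply/funext => w; apply: eq_esum => u _; rewrite mul1r.
move=> fin lim; split => //; apply: cvg_trans lim; apply: near_eq_cvg.
apply: nearW => n; congr (_ * _)%E.
under eq_integral do rewrite sumr_const card_ord mul1n.
by rewrite integral_cst//= probability_setT mule1 natrX.
Qed.

(** On the grid the identity is exact, by independence of the increments. In
    the limit the factor at a grid point becomes its left limit at a jump
    time on one side, and a Riemann sum becomes an integral on the other;
    continuity of [f] is used for both. *)
Lemma continuous_compensation (f : R -> R) (M : nat) :
  continuous f -> (forall x, 0 <= f x <= 1) ->
  [/\ measurable_fun setT (fun w => jump_sum f phi M (level w)),
      measurable_fun setT (fun w => area f M (level w)),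
      forall w, jump_sum f phi M (level w) \is a fin_num,
      forall w, area f M (level w) \is a fin_num &
      (\int[P]_w area f M (level w) < +oo)%E /\
      (\int[P]_w jump_sum f phi M (level w) =
       jump_intensity phi * \int[P]_w area f M (level w))%E].
Proof.
move=> cf fb.
have f0 x : 0 <= f x by have /andP[] := fb x.
pose g w t := f (level w t) * alive_ind (level w) t.
have gb w t : 0 <= g w t <= 1.
  have /andP[a0 a1] := alive_indP (level w) t; have /andP[_ f1] := fb (level w t).
  by rewrite mulr_ge0//= -[leRHS]mul1r ler_pM.
pose X n k w := g w (grid n k).
have mX n k : measurable_fun [set: g_sigma_algebraType (past J V (grid n k))]
     (X n k : g_sigma_algebraType (past J V (grid n k)) -> R).
  apply: measurable_funM; last exact: past_alive_ind.
  apply: (measurableT_comp (continuous_measurable_fun cf)).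
  by apply: past_level; rewrite grid_ge0 lexx.
have [] := jump_sum_limit J_levy V_indep nu_jump J_exponent m0 e0 phi0 cphi phib
  (y := fun w u => f (left_limit (level w) u) * horizon_ind (level w) u) (M := M) mX.
- by move=> n k w; exact: gb.
- move=> w u u0 uM; apply: cvgM; last exact: cvg_alive_ind_grid.
  apply: (@continuous_cvg _ _ _ _ _ _ f); first exact: cf.
  by apply: cvg_left_grid => //; exact: cadlag_level.
set D0 := (fun w => \esum_(u in `]0, M%:R]) (f (left_limit (level w) u) *
    horizon_ind (level w) u * phi (jump (fun x : R => J x w) u))%:E).
have DE : (fun w => jump_sum f phi M (level w)) = D0.
  apply/funext => w; apply: eq_esum => u; rewrite /= in_itv/= => /andP[u0 _].
  by rewrite jump_shift//; exact: levy_cadlag.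
rewrite -DE.
move=> mD Dfin _ lim.
have gc w t : 0 <= t -> g w x @[x --> t^'+] --> g w t.
  move=> t0; apply: cvgM; last by apply: cvg_alive_ind_right => //; exact: cadlag_level.
  apply: (@continuous_cvg _ _ _ _ _ _ f); first exact: cf.
  exact: (cadlag_level w).1.
have gr w := riemann_sum_cvg (g := g w) (M := M) (gc w) (fun t _ => gb w t).
pose a n w := 2 ^- n * \sum_(k < M * 2 ^ n) X n k w.
have ab n w : 0 <= a n w <= M%:R.
  have p := pow2_gt0 (R := R) n.
  rewrite /a mulr_ge0 ?invr_ge0 ?(ltW p)//=; last first.
    by apply: sumr_ge0 => k _; have /andP[] := gb w (grid n k).
  rewrite ler_pdivrMl//; apply: (@le_trans _ _ (\sum_(k < M * 2 ^ n) 1)).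
    by apply: ler_sum => k _; have /andP[] := gb w (grid n k).
  by rewrite sumr_const card_ord natrM natrX mulrC.
have mX' n k : measurable_fun setT (X n k).
  by apply: measurable_generated (mX n k); exact: past_measurable.
have ma n : measurable_fun setT (a n).
  by apply: measurable_funM => //; exact: measurable_sum.
pose Z w := fine (area f M (level w)).
have AZ w : area f M (level w) = (Z w)%:E.
  have A0 : (0 <= area f M (level w))%E.
    by apply: integral_ge0 => t _; rewrite lee_fin; have /andP[] := gb w t.
  rewrite /Z fineK// ge0_fin_numE//.
  have aA := gr w; apply: (@le_lt_trans _ _ M%:R%:E); last exact: ltry.
  rewrite /area -(cvg_lim (@ereal_hausdorff R) aA); apply: lime_le.
    exact: cvgP aA.
  by apply: nearW => n; rewrite lee_fin; have /andP[] := ab n w.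
have aZ w : a n w @[n --> \oo] --> Z w.
  by have := gr w; rewrite -/(area f M (level w)) AZ => /fine_cvgP[].
have mA : measurable_fun setT (fun w => area f M (level w)).
  have -> : (fun w => area f M (level w)) = EFin \o Z by apply/funext => w; exact: AZ.
  by apply/measurable_EFinP; exact: (measurable_fun_cvg (h := a)).
have EA : (\int[P]_w (a n w)%:E)%E @[n --> \oo] --> (\int[P]_w area f M (level w))%E.
  have -> : (\int[P]_w area f M (level w) = \int[P]_w (Z w)%:E)%E.
    by apply: eq_integral => w _; exact: AZ.
  exact: (bounded_cvg_expectation ma ab).
have [kfin kcvg] := jump_intensity_cvg.
have k0 : (0 <= jump_intensity phi)%E.
  apply: integral_ge0 => w _; apply: esum_ge0 => u _.
  by rewrite lee_fin; have /andP[] := phib (jump (J^~ w) u).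
have A0 : (0 <= \int[P]_w area f M (level w))%E.
  by apply: integral_ge0 => w _; apply: integral_ge0 => t _; rewrite lee_fin;
    have /andP[] := gb w t.
have Afin : (\int[P]_w area f M (level w) < +oo)%E.
  apply: (@le_lt_trans _ _ M%:R%:E); last exact: ltry.
  rewrite -(cvg_lim (@ereal_hausdorff R) EA); apply: lime_le.
    exact: cvgP EA.
  apply: nearW => n; apply: (@le_trans _ _ (\int[P]_w (cst M%:R%:E w))%E).
    apply: ge0_le_integral => //.
    - by move=> w _; rewrite lee_fin; have /andP[] := ab n w.
    - exact/measurable_EFinP.
    - by move=> w _; rewrite lee_fin; have /andP[] := ab n w.
  by rewrite integral_cst//= probability_setT mule1.
split => //.
- by move=> w; have -> : jump_sum f phi M (level w) = D0 w by [rewrite -DE]; exact: Dfin.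
- by move=> w; rewrite AZ.
split => //.
have def : (jump_intensity phi *? \int[P]_w area f M (level w))%E.
  by apply: mule_def_fin; rewrite ge0_fin_numE.
have lim2 := cvgeM def kcvg EA.
rewrite -(cvg_lim (@ereal_hausdorff R) lim); apply/cvg_lim; first exact: ereal_hausdorff.
suff -> : (fun n => ((\int[P]_w (\sum_(k < M * 2 ^ n) X n k w)%:E) *
        \int[P]_w (phi (J (2 ^- n)%R w))%:E)%E) =
    ((fun n : nat => (2 ^+ n)%:E * \int[P]_w (phi (J (2 ^- n)%R w))%:E) \*
    (fun n : nat => \int[P]_w (a n w)%:E))%E by exact: lim2.
apply/funext => n /=.
have p := pow2_gt0 (R := R) n.
have -> : (\int[P]_w (\sum_(k < M * 2 ^ n) X n k w)%:E =
    (2 ^+ n)%:E * \int[P]_w (a n w)%:E)%E.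
  rewrite -ge0_integralZl_EFin//; last 2 first.
  - by move=> w _; rewrite lee_fin; have /andP[] := ab n w.
  - exact/measurable_EFinP.
  by apply: eq_integral => w _; rewrite -EFinM /a mulrA divff ?mul1r// gt_eqF.
by rewrite muleAC.
Qed.

End ContinuousCase.

(** * Extension to Borel functions *)

Section PositiveFunctionals.
Context {R : realType}.

(** What the jump functional and the area functional have in common with
    integration against a measure. *)
Record positive_functional (L : (R -> R) -> \bar R) : Prop := PositiveFunctional {
  pf_ge0 : forall f : R -> R, (forall x, 0 <= f x) -> (0 <= L f)%E ;
  pf_add : forall f g : R -> R, measurable_fun setT f -> measurable_fun setT g ->
    (forall x, 0 <= f x) -> (forall x, 0 <= g x) ->
    L (fun x => f x + g x) = (L f + L g)%E ;
  pf_scale : forall (k : R) (f : R -> R), 0 <= k -> measurable_fun setT f ->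
    (forall x, 0 <= f x) -> L (fun x => k * f x) = (k%:E * L f)%E ;
  pf_mono : forall (F : nat -> R -> R) (f : R -> R), (forall n, measurable_fun setT (F n)) ->
    (forall n x, 0 <= F n x) ->
    (forall n k x, (n <= k)%N -> F n x <= F k x) ->
    (forall x, F n x @[n --> \oo] --> f x) ->
    (forall n, L (F n) <= L f)%E /\
    L (F n) @[n --> \oo] --> L f }.

Lemma pf_le (L : (R -> R) -> \bar R) (f g : R -> R) : positive_functional L ->
  measurable_fun setT f -> measurable_fun setT g -> (forall x, 0 <= f x <= g x) ->
  (L f <= L g)%E.
Proof.
move=> pL mf mg fg.
have -> : g = (fun x => f x + (g x - f x)) by apply/funext => x; ring.
rewrite (pf_add pL)//.
- by rewrite leeDl// (pf_ge0 pL)// => x; rewrite subr_ge0; have /andP[] := fg x.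
- exact: measurable_funB.
- by move=> x; have /andP[] := fg x.
- by move=> x; rewrite subr_ge0; have /andP[] := fg x.
Qed.

Lemma nonneg_increasing_simple (f : R -> R) : measurable_fun setT f -> (forall x, 0 <= f x) ->
  exists F : nat -> {nnsfun R >-> R},
    (forall n k x, (n <= k)%N -> F n x <= F k x) /\
    (forall x, F n x @[n --> \oo] --> f x).
Proof.
move=> mf f0; have mfe : measurable_fun setT (EFin \o f) by exact/measurable_EFinP.
exists (nnsfun_approx measurableT mfe); split => [n k x nk|x].
  exact: (lefP _ _ (nd_nnsfun_approx measurableT mfe nk)).
have f0' y : [set: R] y -> (0 <= (EFin \o f) y)%E by rewrite lee_fin.
have := cvg_nnsfun_approx measurableT mfe f0' (I : [set: R] x).
by move=> /fine_cvgP[_]; apply: cvg_trans; apply: near_eq_cvg; exact: nearW.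
Qed.

End PositiveFunctionals.

Section MonotoneClass.
Context {d : measure_display} {T : measurableType d} {R : realType}.
Variables (P : probability T R) (L1 L2 : T -> (R -> R) -> \bar R) (kappa : \bar R).
Hypothesis L1_pf : forall w, positive_functional (L1 w).
Hypothesis L2_pf : forall w, positive_functional (L2 w).
Hypothesis kappa_fin : kappa \is a fin_num.
Hypothesis kappa_ge0 : (0 <= kappa)%E.

Definition compensated (f : R -> R) : Prop :=
  [/\ measurable_fun setT (fun w => L1 w f), measurable_fun setT (fun w => L2 w f) &
     (\int[P]_w L1 w f = kappa * \int[P]_w L2 w f)%E].

Lemma pf_mono_integral (L : T -> (R -> R) -> \bar R) (F : nat -> R -> R) (f : R -> R) :
  (forall w, positive_functional (L w)) ->
  (forall n, measurable_fun setT (fun w => L w (F n))) ->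
  (forall n, measurable_fun setT (F n)) -> (forall n x, 0 <= F n x) ->
  (forall n k x, (n <= k)%N -> F n x <= F k x) ->
  (forall x, F n x @[n --> \oo] --> f x) ->
  measurable_fun setT (fun w => L w f) /\
  (\int[P]_w L w (F n))%E @[n --> \oo] --> (\int[P]_w L w f)%E.
Proof.
move=> pL mL mF F0 Finc Ff.
have lim w : L w (F n) @[n --> \oo] --> L w f by have [] := pf_mono (pL w) mF F0 Finc Ff.
split; first exact: (emeasurable_fun_cvg (fun n w => L w (F n))).
have := @cvg_monotone_convergence _ _ _ P setT measurableT (fun n w => L w (F n)) mL.
have -> : (\int[P]_w L w f = \int[P]_w limn (fun n => L w (F n)))%E.
  by apply: eq_integral => w _; apply/esym/cvg_lim => //; exact: lim.
apply.
- by move=> n w _; exact: pf_ge0.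
- move=> w _ n k nk; apply: (pf_le (pL w)) => // x.
  by rewrite F0 Finc.
Qed.

Lemma compensated_mono (F : nat -> R -> R) (f : R -> R) :
  (forall n, compensated (F n)) ->
  (forall n, measurable_fun setT (F n)) -> (forall n x, 0 <= F n x) ->
  (forall n k x, (n <= k)%N -> F n x <= F k x) ->
  (forall x, F n x @[n --> \oo] --> f x) -> compensated f.
Proof.
move=> cF mF F0 Finc Ff.
have [m1 c1] := pf_mono_integral L1_pf (fun n => let: And3 h _ _ := cF n in h) mF F0 Finc Ff.
have [m2 c2] := pf_mono_integral L2_pf (fun n => let: And3 _ h _ := cF n in h) mF F0 Finc Ff.
split => //; rewrite -(cvg_lim (@ereal_hausdorff R) c1).
apply/cvg_lim; first exact: ereal_hausdorff.
have := cvgeZl kappa_fin c2.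
suff -> : (fun n => (\int[P]_w L1 w (F n))%E) = (fun n => (kappa * \int[P]_w L2 w (F n))%E) by [].
by apply/funext => n; have [] := cF n.
Qed.

Lemma compensated_add (f g : R -> R) : measurable_fun setT f -> measurable_fun setT g ->
  (forall x, 0 <= f x) -> (forall x, 0 <= g x) ->
  compensated f -> compensated g -> compensated (fun x => f x + g x).
Proof.
move=> mf mg f0 g0 [f1 f2 fE] [g1 g2 gE].
have E1 : (fun w => L1 w (fun x => f x + g x)) = (fun w => L1 w f + L1 w g)%E.
  by apply/funext => w; rewrite (pf_add (L1_pf w)).
have E2 : (fun w => L2 w (fun x => f x + g x)) = (fun w => L2 w f + L2 w g)%E.
  by apply/funext => w; rewrite (pf_add (L2_pf w)).
rewrite /compensated E1 E2; split; [exact: emeasurable_funD|exact: emeasurable_funD|].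
have p1 h : (forall x, 0 <= h x) -> forall w, [set: T] w -> (0 <= L1 w h)%E.
  by move=> h0 w _; exact: pf_ge0.
have p2 h : (forall x, 0 <= h x) -> forall w, [set: T] w -> (0 <= L2 w h)%E.
  by move=> h0 w _; exact: pf_ge0.
rewrite !ge0_integralD//; try (exact: p1); try (exact: p2).
by rewrite ge0_muleDr ?fE ?gE//; apply: integral_ge0; exact: p2.
Qed.

Lemma compensated_scale (k : R) (f : R -> R) : 0 <= k -> measurable_fun setT f ->
  (forall x, 0 <= f x) -> compensated f -> compensated (fun x => k * f x).
Proof.
move=> k0 mf f0 [f1 f2 fE].
have E1 : (fun w => L1 w (fun x => k * f x)) = (fun w => k%:E * L1 w f)%E.
  by apply/funext => w; rewrite (pf_scale (L1_pf w)).
have E2 : (fun w => L2 w (fun x => k * f x)) = (fun w => k%:E * L2 w f)%E.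
  by apply/funext => w; rewrite (pf_scale (L2_pf w)).
rewrite /compensated E1 E2; split; [exact: measurable_funeM|exact: measurable_funeM|].
rewrite !ge0_integralZl_EFin//; last 2 first.
- by move=> w _; exact: pf_ge0.
- by move=> w _; exact: pf_ge0.
by rewrite fE muleCA.
Qed.

Hypothesis L1_fin : forall w, L1 w (fun=> 1) \is a fin_num.
Hypothesis L2_fin : forall w, L2 w (fun=> 1) \is a fin_num.
Hypothesis EL2_fin : (\int[P]_w L2 w (fun=> 1%R) < +oo)%E.
Hypothesis continuous_compensated : forall f : R -> R, continuous f ->
  (forall x, 0 <= f x <= 1) -> compensated f.

Lemma compensated_diff (f g : R -> R) : measurable_fun setT f -> measurable_fun setT g ->
  (forall x, 0 <= f x <= g x) -> (forall x, g x <= 1) ->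
  compensated f -> compensated g -> compensated (fun x => g x - f x).
Proof.
move=> mf mg fg g1 cf cg.
have f0 x : 0 <= f x by have /andP[] := fg x.
have h0 x : 0 <= g x - f x by rewrite subr_ge0; have /andP[] := fg x.
have mh : measurable_fun setT (fun x => g x - f x) by exact: measurable_funB.
have fin (L : T -> (R -> R) -> \bar R) : (forall w, positive_functional (L w)) ->
    (forall w, L w (fun=> 1) \is a fin_num) -> forall w, L w f \is a fin_num.
  move=> pL L1f w; rewrite ge0_fin_numE ?(pf_ge0 (pL w))//.
  apply: (@le_lt_trans _ _ (L w (fun=> 1))); last by rewrite -ge0_fin_numE// (pf_ge0 (pL w)).
  by apply: pf_le => // x; rewrite f0 (le_trans _ (g1 x))//; have /andP[] := fg x.
have E (L : T -> (R -> R) -> \bar R) : (forall w, positive_functional (L w)) ->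
    (forall w, L w (fun=> 1) \is a fin_num) ->
    forall w, L w (fun x => g x - f x) = (L w g - L w f)%E.
  move=> pL L1f w; have -> : L w g = (L w (fun x => (g x - f x)%R) + L w f)%E.
    rewrite -(pf_add (pL w))//; congr (L w); apply/funext => x; ring.
  by rewrite addeK// fin.
have [f1 f2 fE] := cf; have [g1' g2 gE] := cg.
have mE (L : T -> (R -> R) -> \bar R) : (forall w, positive_functional (L w)) ->
    (forall w, L w (fun=> 1) \is a fin_num) ->
    measurable_fun setT (fun w => L w g) -> measurable_fun setT (fun w => L w f) ->
    measurable_fun setT (fun w => L w (fun x => g x - f x)).
  move=> pL L1f mLg mLf; have -> := funext (E L pL L1f).
  exact: emeasurable_funB.
have m1 := mE _ L1_pf L1_fin g1' f1; have m2 := mE _ L2_pf L2_fin g2 f2.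
split => //.
have D (L : T -> (R -> R) -> \bar R) : (forall w, positive_functional (L w)) ->
    measurable_fun setT (fun w => L w (fun x => g x - f x)) ->
    measurable_fun setT (fun w => L w f) ->
    (\int[P]_w L w g = \int[P]_w L w (fun x => (g x - f x)%R) + \int[P]_w L w f)%E.
  move=> pL mLd mLf; rewrite -ge0_integralD//; last 2 first.
  - by move=> w _; exact: pf_ge0.
  - by move=> w _; exact: pf_ge0.
  apply: eq_integral => w _; rewrite -(pf_add (pL w))//.
  by congr (L w); apply/funext => x; ring.
have If2 : (\int[P]_w L2 w f)%E \is a fin_num.
  rewrite ge0_fin_numE; last by apply: integral_ge0 => w _; exact: pf_ge0.
  apply: le_lt_trans EL2_fin; apply: ge0_le_integral => //.
  - by move=> w _; exact: pf_ge0.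
  - have [] // := @continuous_compensated (fun=> 1); first by move=> x; exact: cvg_cst.
    by move=> x; rewrite ler01 lexx.
  - move=> w _; apply: pf_le => // x.
    by rewrite f0 (le_trans _ (g1 x))//; have /andP[] := fg x.
have := D _ L1_pf m1 f1; rewrite fE gE (D _ L2_pf m2 f2).
rewrite ge0_muleDr; try by apply: integral_ge0 => w _; exact: pf_ge0.
have kf : (kappa * \int[P]_w L2 w f)%E \is a fin_num by exact: fin_numM.
move=> /(congr1 (fun x => x - kappa * \int[P]_w L2 w f)%E).
by rewrite !addeK.
Qed.

Let positive_part_approx (x : R) (n : nat) (y : R) : R :=
  Num.min 1 (n%:R * Num.max 0 (y - x)).

(** The indicator of an open ray is an increasing limit of continuous
    functions. *)
Lemma compensated_ray (x : R) : compensated \1_(`]x, +oo[%classic : set R).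
Proof.
pose F := positive_part_approx x.
have F01 n y : 0 <= F n y <= 1.
  by rewrite /F /positive_part_approx le_min ler01 mulr_ge0 ?le_max ?lexx//= ge_min lexx.
have cF n : continuous (F n).
  move=> y.
  apply: (@continuous_min R R (fun=> 1) (fun y => n%:R * Num.max 0 (y - x)) y).
    exact: cst_continuous.
  apply: cvgMr; apply: (@continuous_max R R (fun=> 0) (fun y => y - x) y).
    exact: cst_continuous.
  by apply: cvgB; [exact: cvg_id|exact: cvg_cst].
apply: (@compensated_mono F).
- by move=> n; exact: continuous_compensated.
- by move=> n; exact: continuous_measurable_fun.
- by move=> n y; have /andP[] := F01 n y.
- move=> n k y nk; rewrite /F /positive_part_approx.
  rewrite le_min ge_min lexx/= ge_min ler_wpM2r ?orbT//.
    by rewrite le_max lexx.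
  by rewrite ler_nat.
- move=> y; rewrite indicE; have [yx|xy] := leP y x.
    rewrite memNset; last by rewrite /= in_itv/= andbT; apply/negP; rewrite -leNgt.
    apply: cvg_near_cst; apply: nearW => n.
    rewrite /F /positive_part_approx (max_idPl _) ?subr_le0// mulr0.
    by apply/min_idPr.
  rewrite mem_set; last by rewrite /= in_itv/= andbT.
  apply: cvg_near_cst; have [N N1] : exists N : nat, 1 <= N%:R * (y - x).
    have [i ih] := inv_succ_le (etrans (subr_gt0 _ _) xy).
    by exists i.+1; rewrite -ler_pdivrMl// mulr1.
  apply: filterS (nbhs_infty_ge N) => n Nn.
  rewrite /F /positive_part_approx; apply/min_idPl.
  rewrite (max_idPr _) ?subr_ge0 ?(ltW xy)//.
  by apply: (le_trans N1); rewrite ler_pM2r ?subr_gt0// ler_nat.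
Qed.

(** From rays to Borel sets by Dynkin's lemma. *)
Lemma compensated_indic (A : set R) : measurable A -> compensated \1_A.
Proof.
move=> mA; pose H := [set B : set R | measurable B /\ compensated \1_B].
suff : (<<s RGenOInfty.G (R := R) >> : set (set R)) `<=` H.
  move=> GH; have [] // : H A; apply: GH.
  have : (RGenOInfty.G (R := R)).-sigma.-measurable A by rewrite -RGenOInfty.measurableE.
  by [].
have i01 (B : set R) x : 0 <= (\1_B x : R) <= 1.
  by rewrite indicE ler0n lern1; case: (_ \in _).
apply: lambda_system_subset => //.
- move=> _ _ [x ->] [y ->]; exists (Num.max x y); apply/seteqP; split => z /=.
    by rewrite !in_itv/= !andbT gt_max => -[-> ->].
  by rewrite !in_itv/= !andbT gt_max => /andP[].
- split => //.
  + split => //; rewrite indicT; apply: continuous_compensated; first exact: cst_continuous.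
    by move=> x; rewrite /= ler01 lexx.
  + move=> B C CB [mB cB] [mC cC]; split; first exact: measurableD.
    have -> : \1_(B `\` C) = (fun x => \1_B x - \1_C x) :> (R -> R).
      apply/funext => x; rewrite !indicE.
      have [xC|xC] := pselect (C x).
        rewrite (mem_set xC) (mem_set (CB _ xC)) subrr memNset//.
        by move=> [].
      rewrite (memNset xC) subr0; congr (nat_of_bool _)%:R.
      by apply/idP/idP => [/set_mem[xB _]|/set_mem xB]; apply/mem_set.
    apply: compensated_diff => //; try exact: measurable_indic.
    * move=> x; rewrite !indicE ler0n ler_nat /=.
      by have [xC|xC] := pselect (C x); [rewrite (mem_set xC) (mem_set (CB _ xC))|rewrite
        (memNset xC)].
  + move=> F Finc FH; split; first by apply: bigcup_measurable => k _; have [] := FH k.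
    apply: (@compensated_mono (fun n => \1_(F n))).
    * by move=> n; have [] := FH n.
    * by move=> n; apply: measurable_indic; have [] := FH n.
    * by move=> n x; have /andP[] := i01 (F n) x.
    * move=> n k x nk; rewrite !indicE ler_nat.
      have [xF|xF] := pselect (F n x); last by rewrite (memNset xF).
      rewrite (mem_set xF) mem_set//.
      by have /subsetPset := Finc n k nk; apply.
    * move=> x; apply: cvg_near_cst; rewrite !indicE.
      have [[N _ xF]|xF] := pselect ((\bigcup_n F n) x).
        apply: filterS (nbhs_infty_ge N) => n Nn; rewrite !indicE mem_set.
          by rewrite mem_set//; exists N.
        by have /subsetPset := Finc N n Nn; apply.
      apply: nearW => n; rewrite !indicE (memNset xF) memNset// => xn.
      by apply: xF; exists n.
- move=> _ [x ->]; split; first exact: measurable_itv.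
  exact: compensated_ray.
Qed.

Theorem compensated_nonneg (f : R -> R) : measurable_fun setT f -> (forall x, 0 <= f x) ->
  compensated f.
Proof.
move=> mf f0; have [F [Finc Ff]] := nonneg_increasing_simple mf f0.
apply: (@compensated_mono (fun n => F n)) => // n.
have step (s : seq R) : (forall y, y \in s -> 0 <= y) ->
    let g x := \sum_(y <- s) y * \1_(F n @^-1` [set y]) x in
    [/\ compensated g, measurable_fun setT g & forall x, 0 <= g x].
  elim: s => [_ g|y s ih s0 g].
    have -> : g = (fun=> 0) by apply/funext => x; rewrite /g big_nil.
    split => //; apply: continuous_compensated; first exact: cst_continuous.
    by move=> x; rewrite lexx ler01.
  have y0 : 0 <= y by apply: s0; rewrite mem_head.
  have [cs ms gs] := ih (fun z zs => s0 z (mem_behead (zs : z \in behead (y :: s)))).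
  have -> : g = (fun x => y * \1_(F n @^-1` [set y]) x +
      \sum_(y <- s) y * \1_(F n @^-1` [set y]) x).
    by apply/funext => x; rewrite /g big_cons.
  have mi : measurable_fun setT (\1_(F n @^-1` [set y]) : R -> R).
    exact: measurable_indic.
  have i0 x : 0 <= (\1_(F n @^-1` [set y]) x : R) by rewrite indicE.
  have m1 : measurable_fun setT (fun x : R => y * \1_(F n @^-1` [set y]) x : R).
    exact: measurable_funM.
  split.
  - apply: compensated_add => //; first by move=> x; exact: mulr_ge0.
    apply: compensated_scale => //.
    exact: compensated_indic.
  - exact: measurable_funD.
  - by move=> x; apply: addr_ge0 => //; exact: mulr_ge0.
have /finite_seqP[s0 s0E] : finite_set (range (F n)) by exact: fimfunP.
have sE : range (F n) = [set` undup s0].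
  by rewrite s0E; apply/seteqP; split => y /=; rewrite mem_undup.
have [] := step (undup s0).
  move=> y ys; have : range (F n) y by rewrite sE.
  by move=> [x _ <-].
move=> cs _ _; apply: (eq_ind_r compensated cs).
by apply/funext => x; rewrite fimfunE sE -fsbig_seq// undup_uniq.
Qed.

End MonotoneClass.

Section MonotoneLimits.
Context {R : realType}.

Lemma cvge_ge_nd (a : nat -> \bar R) (b : \bar R) n :
  (forall n k, (n <= k)%N -> (a n <= a k)%E) -> a n @[n --> \oo] --> b -> (a n <= b)%E.
Proof.
move=> ainc ab; rewrite -(cvg_lim (@ereal_hausdorff R) ab); apply: lime_ge.
  exact: cvgP ab.
by apply: filterS (nbhs_infty_ge n) => k; exact: ainc.
Qed.

Lemma esum_nondecreasing_cvg (I : choiceType) (S : set I) (a : nat -> I -> \bar R)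
    (b : I -> \bar R) :
  (forall n i, S i -> (0 <= a n i)%E) ->
  (forall n k i, S i -> (n <= k)%N -> (a n i <= a k i)%E) ->
  (forall i, S i -> a n i @[n --> \oo] --> b i) ->
  (\esum_(i in S) a n i) @[n --> \oo] --> \esum_(i in S) b i.
Proof.
move=> a0 ainc ab.
have inc : {homo (fun n => \esum_(i in S) a n i) : n k / (n <= k)%N >-> (n <= k)%E}.
  by move=> n k nk; apply: le_esum => i Si; exact: ainc.
have := ereal_nondecreasing_cvgn inc.
suff -> : ereal_sup (range (fun n => \esum_(i in S) a n i)) = \esum_(i in S) b i by [].
apply/eqP; rewrite eq_le; apply/andP; split.
  apply: ge_ereal_sup => _ [n _ <-]; apply: le_esum => i Si.
  by apply: (cvge_ge_nd (a := a^~ i)) => [k l|]; [exact: ainc|exact: ab].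
apply: ge_ereal_sup => _ [X [finX XS] <-].
have : (\sum_(i \in X) a n i)%R @[n --> \oo] --> (\sum_(i \in X) b i)%R.
  have /finite_seqP[s0 s0E] := finX.
  have sE : X = [set` undup s0].
    by rewrite s0E; apply/seteqP; split => y /=; rewrite mem_undup.
  have bs (g : I -> \bar R) : (\sum_(i \in X) g i)%R =
      (\sum_(i <- undup s0 | i \in undup s0) g i)%R.
    by rewrite sE -fsbig_seq ?undup_uniq// big_seq.
  have -> : (fun n => (\sum_(i \in X) a n i)%R) =
      (fun n => (\sum_(i <- undup s0 | i \in undup s0) a n i)%R).
    by apply/funext => n; exact: bs.
  rewrite bs; apply: cvg_nnesum => i ius.
    by apply: nearW => n; apply: a0; apply: XS; rewrite sE.
  by apply: ab; apply: XS; rewrite sE.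
move=> h; rewrite -(cvg_lim (@ereal_hausdorff R) h); apply: lime_le; first exact: cvgP h.
apply: nearW => n; apply: (@le_trans _ _ (\esum_(i in S) a n i)).
  by apply: ereal_sup_ubound; exists X.
by apply: ereal_sup_ubound; exists n.
Qed.

Lemma esumZl (I : choiceType) (S : set I) (k : R) (a : I -> \bar R) : 0 <= k ->
  (forall i, (0 <= a i)%E) ->
  \esum_(i in S) (k%:E * a i)%E = (k%:E * \esum_(i in S) a i)%E.
Proof.
have le (l : R) (b : I -> \bar R) : 0 <= l -> (forall i, (0 <= b i)%E) ->
    (\esum_(i in S) (l%:E * b i)%E <= l%:E * \esum_(i in S) b i)%E.
  move=> l0 b0; apply: ge_ereal_sup => _ [X [finX XS] <-].
  rewrite -ge0_mule_fsumr//.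
  by rewrite lee_wpmul2l ?lee_fin//; apply: ereal_sup_ubound; exists X.
rewrite le_eqVlt => /predU1P[<- a0|k0 a0].
  by rewrite mul0e esum1// => i _; rewrite mul0e.
apply/eqP; rewrite eq_le (le _ _ (ltW k0) a0)/=.
have -> : \esum_(i in S) a i = \esum_(i in S) (k^-1%:E * (k%:E * a i))%E.
  by apply: eq_esum => i _; rewrite muleA -EFinM mulVf ?gt_eqF// mul1e.
apply: (@le_trans _ _ (k%:E * (k^-1%:E * \esum_(i in S) (k%:E * a i)%E))%E).
  rewrite lee_wpmul2l ?lee_fin ?(ltW k0)// le// ?invr_ge0 ?(ltW k0)// => i.
  by rewrite mule_ge0 ?lee_fin ?(ltW k0)// a0.
by rewrite muleA -EFinM divff ?gt_eqF// mul1e.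
Qed.

(** Even in the indeterminate case [0 * +oo], since a vanishing bound forces
    all the terms to vanish. *)
Lemma cvgeM_nd (a b : nat -> \bar R) (A B : \bar R) :
  (forall n, (0 <= a n <= A)%E) -> (forall n, (0 <= b n <= B)%E) ->
  a n @[n --> \oo] --> A -> b n @[n --> \oo] --> B ->
  (a n * b n)%E @[n --> \oo] --> (A * B)%E.
Proof.
move=> aA bB lA lB.
have A0 : (0 <= A)%E by have /andP[] := aA 0%N; exact: le_trans.
have B0 : (0 <= B)%E by have /andP[] := bB 0%N; exact: le_trans.
have [AE|An] := eqVneq A 0%E.
  rewrite AE mul0e; apply: cvg_near_cst; apply: nearW => n.
  by have := aA n; rewrite AE -eq_le => /eqP <-; rewrite mul0e.
have [BE|Bn] := eqVneq B 0%E.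
  rewrite BE mule0; apply: cvg_near_cst; apply: nearW => n.
  by have := bB n; rewrite BE -eq_le => /eqP <-; rewrite mule0.
by apply: cvgeM lA lB; rewrite mule_defE (negbTE An) (negbTE Bn).
Qed.

End MonotoneLimits.

Section FunctionalsArePositive.
Context {R : realType}.
Implicit Types (w f phi : R -> R).

Lemma horizon_ind_ge0 w u : 0 <= horizon_ind w u.
Proof. exact: ler0n. Qed.

Lemma jump_sum_positive phi (M : nat) w : (forall z, 0 <= phi z) ->
  positive_functional (fun f => jump_sum f phi M w).
Proof.
move=> phi0.
have c0 u : 0 <= horizon_ind w u * phi (jump w u) by rewrite mulr_ge0// horizon_ind_ge0.
have t0 f u : (forall x, 0 <= f x) ->
    (0 <= (f (left_limit w u) * horizon_ind w u * phi (jump w u))%:E)%E.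
  by move=> f0; rewrite lee_fin -mulrA mulr_ge0.
split.
- by move=> f f0; apply: esum_ge0 => u _; exact: t0.
- move=> f g _ _ f0 g0; rewrite /jump_sum -esumD//; last 2 first.
  + by move=> u _; exact: t0.
  + by move=> u _; exact: t0.
  by apply: eq_esum => u _; rewrite -EFinD; congr _%:E; ring.
- move=> k f k0 _ f0; rewrite /jump_sum -esumZl//.
  + by apply: eq_esum => u _; rewrite -EFinM !mulrA.
  + by move=> u; exact: t0.
- move=> F f mF F0 Finc Ff.
  have lim : jump_sum (F n) phi M w @[n --> \oo] --> jump_sum f phi M w.
    apply: esum_nondecreasing_cvg.
    + by move=> n u _; exact: t0.
    + by move=> n k u _ nk; rewrite lee_fin -!mulrA ler_wpM2r// Finc.
    + move=> u _; apply: cvg_EFin; first exact: nearW.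
      by apply: cvgMl; apply: cvgMl; exact: Ff.
  split => // n; apply: (cvge_ge_nd (a := fun n => jump_sum (F n) phi M w)) lim => {}n k nk.
  by apply: le_esum => u _; rewrite lee_fin -!mulrA ler_wpM2r// Finc.
Qed.

Lemma area_positive (M : nat) w : cadlag w ->
  positive_functional (fun f => area f M w).
Proof.
move=> cw.
have mw : measurable_fun (`]0, M%:R] : set R) w.
  by apply: right_continuous_measurable; exact: cw.1.
have ma : measurable_fun (`]0, M%:R] : set R) (alive_ind w).
  by apply: right_continuous_measurable => t t0; exact: cvg_alive_ind_right.
have a0 t : 0 <= alive_ind w t by have /andP[] := alive_indP w t.
have mf f : measurable_fun setT f ->
    measurable_fun (`]0, M%:R] : set R) (fun t => (f (w t) * alive_ind w t)%:E).
  move=> mf; apply/measurable_EFinP; apply: measurable_funM => //.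
  exact: (measurableT_comp mf).
have t0 f t : (forall x, 0 <= f x) -> `]0, M%:R]%classic t -> (0 <= (f (w t) * alive_ind w t)%:E)%E.
  by move=> f0 _; rewrite lee_fin mulr_ge0.
have mI : measurable (`]0, M%:R]%classic : set R) by exact: measurable_itv.
split.
- by move=> f f0; apply: integral_ge0 => t; exact: t0.
- move=> f g mf' mg f0 g0; rewrite /area -ge0_integralD//.
  + by apply: eq_integral => t _; rewrite -EFinD -mulrDl.
  + by move=> t; exact: t0.
  + exact: mf.
  + by move=> t; exact: t0.
  + exact: mf.
- move=> k f k0 mf' f0; rewrite /area -ge0_integralZl_EFin//.
  + by apply: eq_integral => t _; rewrite -EFinM mulrA.
  + by move=> t; exact: t0.
  + exact: mf.
- move=> F f mF F0 Finc Ff.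
  have lim : area (F n) M w @[n --> \oo] --> area f M w.
    have := @cvg_monotone_convergence _ _ _ lebesgue_measure _ mI
      (fun n t => (F n (w t) * alive_ind w t)%:E).
    have -> : area f M w = (\int[lebesgue_measure]_(t in `]0%R, M%:R%R])
        limn (fun n => (F n (w t) * alive_ind w t)%:E))%E.
      apply: eq_integral => t _; apply/esym/cvg_lim; first exact: ereal_hausdorff.
      by apply: cvg_EFin; [exact: nearW|apply: cvgMl; exact: Ff].
    apply.
    + by move=> n; exact: mf.
    + by move=> n t; exact: t0.
    + by move=> t _ n k nk; rewrite lee_fin ler_wpM2r// Finc.
  split => // n; apply: (cvge_ge_nd (a := fun n => area (F n) M w)) lim => {}n k nk.
  apply: ge0_le_integral => //.
  + by move=> t; exact: t0.
  + exact: mf.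
  + exact: mf.
  + by move=> t _; rewrite lee_fin ler_wpM2r// Finc.
Qed.

End FunctionalsArePositive.

(** * The jump rate *)

Section Compensation.
Context {d : measure_display} {T : measurableType d} {R : realType}.
Context {P : probability T R}.
Variables (J : R -> {RV P >-> R}) (V : {RV P >-> R}).
Variables (c sigma : R) (nu : {measure set R -> \bar R}).
Hypothesis J_levy : levy_process J.
Hypothesis V_indep : indep_systems P (sigma_RV V) (sigma_process `[0, +oo[ J).
Hypothesis nu_jump : jump_measure nu.
Hypothesis J_exponent : forall a : R, 0 <= a ->
  laplace_exponent J a = levy_exponent c sigma nu a.

Let level := level J V.

Lemma borel_compensation (m e : R) (phi : R -> R) (f : R -> R) (M : nat) :
  0 <= m -> 0 < e -> (forall z, `|z| <= e -> phi z = 0) -> continuous phi ->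
  (forall z, 0 <= phi z <= quartic m z) ->
  measurable_fun setT f -> (forall x, 0 <= f x) ->
  compensated P (fun w f => jump_sum f phi M (level w)) (fun w f => area f M (level w))
    (jump_intensity J phi) f.
Proof.
move=> m0 e0 phi0 cphi phib mf f0.
have phi_ge0 z : 0 <= phi z by have /andP[] := phib z.
have [kfin _] := jump_intensity_cvg J_levy V_indep nu_jump J_exponent m0 e0 phi0 cphi phib.
have k0 : (0 <= jump_intensity J phi)%E.
  by apply: integral_ge0 => w _; apply: esum_ge0 => u _; rewrite lee_fin.
have cc (g : R -> R) (cg : continuous g) (gb : forall x, 0 <= g x <= 1) :=
  continuous_compensation J_levy V_indep nu_jump J_exponent m0 e0 phi0 cphi phib M cg gb.
have c1 : continuous (fun _ : R => 1 : R) by move=> x; exact: cvg_cst.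
have b1 (x : R) : 0 <= (1 : R) <= 1 by rewrite ler01 lexx.
have [_ _ D1 A1 [EA1 _]] := cc _ c1 b1.
apply: compensated_nonneg => //.
- by move=> w; exact: jump_sum_positive.
- by move=> w; apply: area_positive; exact: cadlag_level.
- by rewrite ge0_fin_numE.
- by move=> g cg gb; have [? ? _ _ [_ ?]] := cc g cg gb; split.
Qed.

(** Vanishes near [0], as the pathwise limits require. The truncation level is
    squared for the sake of [quartic_sub_test_fun]. *)
Definition test_fun (m : R) (j : nat) (z : R) : R :=
  Num.max 0 (quartic m z - (j.+1%:R^-1) ^+ 2).

Lemma continuous_test_fun m j : continuous (test_fun m j).
Proof.
move=> z.
apply: (@continuous_max R R (fun=> 0) (fun z => quartic m z - (j.+1%:R^-1) ^+ 2) z).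
  exact: cst_continuous.
by apply: cvgB; [exact: continuous_quartic|exact: cvg_cst].
Qed.

Lemma test_funP m j z : 0 <= test_fun m j z <= quartic m z.
Proof.
by rewrite /test_fun le_max lexx/= ge_max quartic_ge0/= gerBl sqr_ge0.
Qed.

Lemma test_fun_near0 m j : exists2 e : R, 0 < e &
  forall z, `|z| <= e -> test_fun m j z = 0.
Proof.
have q0 : quartic m 0 = 0 by rewrite /quartic mulr0 expR0 subrr expr0n.
have d0 : 0 < (j.+1%:R^-1 : R) ^+ 2 by rewrite exprn_gt0// invr_gt0.
have /cvgrPdist_lt/(_ _ d0) := @continuous_quartic R m 0.
move=> /nbhs_normP[e /= e0 he]; exists (e / 2); first by rewrite divr_gt0.
move=> z ze; have := he z; rewrite /= sub0r normrN q0 sub0r normrN.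
have ze' : `|z| < e by apply: le_lt_trans ze _; lra.
move=> /(_ ze'); rewrite ger0_norm ?quartic_ge0// => qz.
by rewrite /test_fun (max_idPl _)// subr_le0 ltW.
Qed.

Lemma le_test_fun m j k z : (j <= k)%N -> test_fun m j z <= test_fun m k z.
Proof.
move=> jk; rewrite /test_fun ge_max le_max lexx/= le_max lerD2l lerN2.
by rewrite ler_sqr ?nnegrE ?invr_ge0// lef_pV2 ?posrE// ler_nat ltnS jk orbT.
Qed.

Lemma test_fun_cvg m z : test_fun m j z @[j --> \oo] --> quartic m z.
Proof.
have -> : quartic m z = Num.max 0 (quartic m z - 0 ^+ 2).
  by rewrite expr0n subr0; apply/esym/max_idPr; exact: quartic_ge0.
have h : quartic m z - (j.+1%:R^-1) ^+ 2 @[j --> \oo] --> quartic m z - 0 ^+ 2.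
  apply: cvgB; first exact: cvg_cst.
  by rewrite expr2; under eq_fun do rewrite expr2; apply: cvgM; exact: cvg_harmonic.
apply: (@continuous_cvg _ _ _ _ _ _ (fun y : R => Num.max 0 y) _ _ h).
by apply: (@continuous_max R R (fun=> 0) id); [exact: cst_continuous|exact: cvg_id].
Qed.

(** For [s] the square root of the quartic and [a = 1 / (j + 1)], truncation
    removes [min (s ^ 2) (a ^ 2)], which is at most [a * s]. *)
Lemma quartic_sub_test_fun m j z :
  quartic m z <= test_fun m j z + j.+1%:R^-1 * (1 - expR (- m * z)) ^+ 2.
Proof.
have d0 : 0 < (j.+1%:R^-1 : R) by rewrite invr_gt0.
rewrite /test_fun /quartic (_ : 4 = 2 * 2)%N// exprM.
set s := (1 - _) ^+ 2; have s0 : 0 <= s by exact: sqr_ge0.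
move: d0; set a := _^-1 => d0; rewrite maxEle.
by case: ifPn => h; nra.
Qed.

Definition quartic_intensity (m : R) : \bar R :=
  (\int[nu]_(y in `]0%R, +oo[) (quartic m y)%:E)%E.

(** The rate of jumps is read off from the Laplace exponent: on a fine grid
    what the truncation removes from [quartic m] is bounded by a small
    multiple of [(1 - exp (- m z)) ^ 2], whose expectation is of the order of
    the mesh. *)
Lemma jump_intensity_quartic (m : R) : 0 <= m ->
  (forall j, (0 <= jump_intensity J (test_fun m j) <= quartic_intensity m)%E) /\
  (jump_intensity J (test_fun m j) @[j --> \oo] --> quartic_intensity m).
Proof.
move=> m0.
pose l N : R := \sum_(k < N.+1) signed_bin N k * - psi c sigma nu (k%:R * m).
pose l4 := l 4; pose l2 := l 2.
have L4 : 2 ^+ n * moment c sigma nu 4 m n @[n --> \oo] --> l4 by exact: moment_cvg.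
have L2 : 2 ^+ n * moment c sigma nu 2 m n @[n --> \oo] --> l2 by exact: moment_cvg.
have QE : quartic_intensity m = l4%:E by exact: fourth_difference_psi.
have kc j : (jump_intensity J (test_fun m j) < +oo)%E /\
  ((2 ^+ n)%:E * \int[P]_w (test_fun m j (J (2 ^- n) w))%:E)%E @[n --> \oo] --> jump_intensity J
    (test_fun m j).
  have [e e0 he] := test_fun_near0 m j.
  apply: (jump_intensity_cvg J_levy V_indep nu_jump J_exponent m0 e0 he).
    exact: continuous_test_fun.
  exact: test_funP.
have k0 j : (0 <= jump_intensity J (test_fun m j))%E.
  apply: integral_ge0 => w _; apply: esum_ge0 => u _; rewrite lee_fin.
  by have /andP[] := test_funP m j (jump (J^~ w) u).
have mt j : measurable_fun setT (test_fun m j).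
  by apply: continuous_measurable_fun; exact: continuous_test_fun.
have m2 : measurable_fun setT (fun z : R => (1 - expR (- m * z)) ^+ 2).
  apply: measurable_funX; apply: measurable_funB => //; exact: measurable_expR_lin.
pose x j := fine (jump_intensity J (test_fun m j)).
have xE j : jump_intensity J (test_fun m j) = (x j)%:E.
  by rewrite /x fineK// ge0_fin_numE//; have [] := kc j.
have p n : 0 < 2 ^+ n :> R by exact: pow2_gt0.
have upper j n : ((2 ^+ n)%:E * \int[P]_w (test_fun m j (J (2 ^- n)%R w))%:E <=
    (2 ^+ n * moment c sigma nu 4 m n)%:E)%E.
  rewrite EFinM lee_wpmul2l ?lee_fin ?(ltW (p n))//.
  rewrite -(momentE J_levy V_indep nu_jump J_exponent)//.
  apply: ge0_le_integral => //.
  - by move=> w _; rewrite lee_fin; have /andP[] := test_funP m j (J (2 ^- n) w).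
  - by apply/measurable_EFinP; apply: (measurableT_comp (mt j)).
  - by apply/measurable_EFinP; apply: (measurableT_comp (measurable_quartic m)).
  - by move=> w _; rewrite lee_fin; have /andP[] := test_funP m j (J (2 ^- n) w).
have lower j n : ((2 ^+ n * moment c sigma nu 4 m n)%:E <=
    (2 ^+ n)%:E * \int[P]_w (test_fun m j (J (2 ^- n)%R w))%:E +
    (j.+1%:R^-1 * (2 ^+ n * moment c sigma nu 2 m n))%:E)%E.
  set a : R := j.+1%:R^-1; have a0 : 0 <= a by rewrite invr_ge0.
  rewrite (_ : a * _ = 2 ^+ n * (a * moment c sigma nu 2 m n)); last by ring.
  rewrite [X in (X <= _)%E]EFinM [X in (_ <= _ + X)%E]EFinM.
  have E2 : ((a * moment c sigma nu 2 m n)%:E =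
      \int[P]_w (a * (1 - expR (- m * J (2 ^- n)%R w)) ^+ 2)%:E)%E.
    rewrite EFinM -(momentE J_levy V_indep nu_jump J_exponent)//.
    rewrite -ge0_integralZl_EFin//.
    - by move=> w _; rewrite lee_fin sqr_ge0.
    - by apply/measurable_EFinP; apply: (measurableT_comp m2).
  have t0 w : 0 <= test_fun m j (J (2 ^- n) w).
    by have /andP[] := test_funP m j (J (2 ^- n) w).
  have mas : measurable_fun setT (fun w => a * (1 - expR (- m * J (2 ^- n) w)) ^+ 2).
    apply: measurable_funM; first exact: measurable_cst.
    exact: (measurableT_comp m2).
  have mtj : measurable_fun setT (fun w => test_fun m j (J (2 ^- n) w)).
    exact: (measurableT_comp (mt j)).
  have as0 w : 0 <= a * (1 - expR (- m * J (2 ^- n) w)) ^+ 2.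
    by rewrite mulr_ge0// sqr_ge0.
  rewrite E2 -ge0_muleDr//; last 2 first.
  - by apply: integral_ge0 => w _; rewrite lee_fin.
  - by apply: integral_ge0 => w _; rewrite lee_fin.
  rewrite lee_wpmul2l ?lee_fin ?(ltW (p n))//.
  rewrite -(momentE J_levy V_indep nu_jump J_exponent)//.
  rewrite -ge0_integralD//; last 4 first.
  - by move=> w _; rewrite lee_fin.
  - exact/measurable_EFinP.
  - by move=> w _; rewrite lee_fin.
  - exact/measurable_EFinP.
  apply: ge0_le_integral => //.
  - by move=> w _; rewrite lee_fin quartic_ge0.
  - by apply/measurable_EFinP; apply: (measurableT_comp (measurable_quartic m)).
  - by apply: emeasurable_funD; exact/measurable_EFinP.
  - by move=> w _; rewrite -EFinD lee_fin; exact: quartic_sub_test_fun.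
have EL4 : (2 ^+ n * moment c sigma nu 4 m n)%:E @[n --> \oo] --> l4%:E.
  by apply: cvg_EFin; first exact: nearW.
have xle j : x j <= l4.
  have [_ lim] := kc j; rewrite -lee_fin -xE -(cvg_lim (@ereal_hausdorff R) lim).
  rewrite -(cvg_lim (@ereal_hausdorff R) EL4); apply: lee_lim.
  - exact: cvgP lim.
  - exact: cvgP EL4.
  - by apply: nearW => n; exact: upper.
have lex j : l4 <= x j + j.+1%:R^-1 * l2.
  have [_ lim] := kc j; rewrite -lee_fin -(cvg_lim (@ereal_hausdorff R) EL4).
  have EL2 : (j.+1%:R^-1 * (2 ^+ n * moment c sigma nu 2 m n))%:E @[n --> \oo] -->
      (j.+1%:R^-1 * l2)%:E.
    by apply: cvg_EFin; [exact: nearW|apply: cvgMr].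
  have lim2 : ((2 ^+ n)%:E * \int[P]_w (test_fun m j (J (2 ^- n)%R w))%:E +
      (j.+1%:R^-1 * (2 ^+ n * moment c sigma nu 2 m n))%:E)%E @[n --> \oo] -->
      (jump_intensity J (test_fun m j) + (j.+1%:R^-1 * l2)%:E)%E.
    by apply: cvgeD; [exact: fin_num_adde_defl|exact: lim|exact: EL2].
  rewrite EFinD -xE -(cvg_lim (@ereal_hausdorff R) lim2); apply: lee_lim.
  - exact: cvgP EL4.
  - exact: cvgP lim2.
  - by apply: nearW => n; exact: lower.
split => //.
  by move=> j; rewrite k0 xE QE lee_fin xle.
rewrite QE; under eq_fun do rewrite xE; apply: cvg_EFin; first exact: nearW.
apply: (@squeeze_cvgr _ _ _ _ (fun j => l4 - j.+1%:R^-1 * l2) (cst l4)).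
- by apply: nearW => j; rewrite xle andbT lerBlDr lex.
- have h : l4 - j.+1%:R^-1 * l2 @[j --> \oo] --> l4 - 0 * l2.
    by apply: cvgB; [exact: cvg_cst|apply: cvgMl; exact: cvg_harmonic].
  by rewrite mul0r subr0 in h.
- exact: cvg_cst.
Qed.

End Compensation.

(** * Unbounded horizon *)

Section QuarticLimit.
Context {R : realType}.
Implicit Types (y z : R).

Lemma quartic_le1 (n : nat) z : 0 <= z -> 0 <= 1 - expR (- n%:R * z) <= 1.
Proof.
move=> z0; rewrite subr_ge0 gerBl expR_ge0 andbT -expR0 ler_expR.
by rewrite mulNr oppr_le0 mulr_ge0.
Qed.

Lemma le_quartic (n k : nat) z : 0 <= z -> (n <= k)%N ->
  quartic n%:R z <= quartic k%:R z.
Proof.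
move=> z0 nk; have /andP[a0 _] := quartic_le1 n z0.
have /andP[b0 _] := quartic_le1 k z0.
rewrite /quartic lerXn2r ?nnegrE// lerD2l lerN2 ler_expR !mulNr lerN2.
by rewrite ler_wpM2r// ler_nat.
Qed.

Lemma quartic_cvg z : 0 <= z ->
  quartic n%:R z @[n --> \oo] --> ((0 < z)%R%:R : R).
Proof.
rewrite le_eqVlt => /predU1P[<-|z0].
  rewrite ltxx; apply: cvg_near_cst; apply: nearW => n.
  by rewrite /quartic mulr0 expR0 subrr expr0n.
have h0 : expR (- n%:R * z) @[n --> \oo] --> (0 : R).
  have := @cvg_geometric R 1 (expR (- z)).
  rewrite ger0_norm ?expR_ge0// -expR0 ltr_expR oppr_lt0 z0 => /(_ isT).
  move=> h; apply: cvg_trans h; apply: near_eq_cvg; apply: nearW => n.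
  by rewrite /geometric/= expR0 mul1r -expRM_natl; congr expR; ring.
have h1 : 1 - expR (- n%:R * z) @[n --> \oo] --> (1 - 0 : R).
  by apply: cvgB; [exact: cvg_cst|exact: h0].
have -> : ((0 < z)%R%:R : R) = (1 - 0) ^+ 4 by rewrite z0 subr0 expr1n.
apply: (@continuous_cvg _ _ _ _ _ _ (fun x : R => x ^+ 4) _ _ h1).
exact: exprn_continuous.
Qed.

Lemma quartic_intensity_cvg (nu : {measure set R -> \bar R}) :
  (forall n, quartic_intensity nu n%:R <= jump_rate nu)%E /\
  quartic_intensity nu n%:R @[n --> \oo] --> jump_rate nu.
Proof.
have mI : measurable (`]0%R, +oo[%classic : set R) by exact: measurable_itv.
have y0 (y : R) : `]0%R, +oo[%classic y -> 0 < y by rewrite /= in_itv/= andbT.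
have lim : quartic_intensity nu n%:R @[n --> \oo] --> jump_rate nu.
  have -> : jump_rate nu = (\int[nu]_(y in `]0%R, +oo[)
      limn (fun n => (quartic n%:R y)%:E))%E.
    rewrite /jump_rate -(mul1e (nu _)) -integral_cst//.
    apply: eq_integral => y; rewrite inE => /y0 yp; apply/esym/cvg_lim;
      first exact: ereal_hausdorff.
    apply: cvg_EFin; first exact: nearW.
    by have := quartic_cvg (ltW yp); rewrite yp.
  apply: cvg_monotone_convergence => //.
  - by move=> n; apply/measurable_EFinP; apply: measurable_funTS; exact: measurable_quartic.
  - by move=> n y _; rewrite lee_fin quartic_ge0.
  - by move=> y /y0 yp n k nk; rewrite lee_fin le_quartic// ltW.
split => // n; apply: (cvge_ge_nd (a := fun n => quartic_intensity nu n%:R)) lim => {}n k nk.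
apply: ge0_le_integral => //.
- by move=> y _; rewrite lee_fin quartic_ge0.
- by apply/measurable_EFinP; apply: measurable_funTS; exact: measurable_quartic.
- by apply/measurable_EFinP; apply: measurable_funTS; exact: measurable_quartic.
- by move=> y /y0 yp; rewrite lee_fin le_quartic// ltW.
Qed.

(** The functionals of the theorem with [horizon] and [alive] in place of
    [until0]. *)
Definition killed_jump_sum (f w : R -> R) : \bar R :=
  \esum_(u in `]0, +oo[)
    (f (left_limit w u) * horizon_ind w u * (0 < jump w u)%R%:R)%:E.

Definition killed_area (f w : R -> R) : \bar R :=
  (\int[lebesgue_measure]_(t in `]0%R, +oo[) (f (w t) * alive_ind w t)%:E)%E.

Lemma jump_sum_cvg (f w : R -> R) : (forall x, 0 <= f x) ->
  (forall u, 0 < u -> 0 <= jump w u) ->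
  (forall n, jump_sum f (quartic n%:R) n w <= jump_sum f (quartic n.+1%:R) n.+1 w)%E /\
  jump_sum f (quartic n%:R) n w @[n --> \oo] --> killed_jump_sum f w.
Proof.
move=> f0 jw.
pose t (n : nat) (u : R) : \bar R := (f (left_limit w u) * horizon_ind w u *
  quartic n%:R (jump w u))%:E.
have t0 n u : (0 <= t n u)%E.
  by rewrite lee_fin; apply: mulr_ge0; [apply: mulr_ge0 => //;
    exact: horizon_ind_ge0|exact: quartic_ge0].
have tle n k u : 0 < u -> (n <= k)%N -> (t n u <= t k u)%E.
  move=> u0 nk; rewrite lee_fin ler_wpM2l ?mulr_ge0// ?horizon_ind_ge0//.
  by apply: le_quartic => //; exact: jw.
pose a (n : nat) (u : R) : \bar R := if u \in `]0, n%:R]%classic then t n u else 0%E.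
have aE n : jump_sum f (quartic n%:R) n w = \esum_(u in `]0, +oo[) a n u.
  rewrite /a -esum_mkcondr; congr esum; apply/seteqP; split => u /=.
    by rewrite !in_itv/= andbT => /andP[-> ->].
  by rewrite !in_itv/= andbT => -[].
have ale n k u : `]0, +oo[%classic u -> (n <= k)%N -> (a n u <= a k u)%E.
  rewrite /= in_itv/= andbT => u0 nk; rewrite /a.
  case: ifPn => [|_]; last by case: ifPn.
  rewrite inE/= in_itv/= => /andP[_ un].
  rewrite mem_set; first exact: tle.
  by rewrite /= in_itv/= u0 (le_trans un)// ler_nat.
split; first by move=> n; rewrite !aE; apply: le_esum => u up; exact: ale.
rewrite (_ : (fun n => _) = (fun n => \esum_(u in `]0, +oo[) a n u)); last exact/funext.
apply: esum_nondecreasing_cvg.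
- by move=> n u _; rewrite /a; case: ifPn.
- by move=> n k u up nk; exact: ale.
- move=> u; rewrite /= in_itv/= andbT => u0.
  have h : t n u @[n --> \oo] --> (f (left_limit w u) * horizon_ind w u * (0 < jump w u)%R%:R)%:E.
    apply: cvg_EFin; first exact: nearW.
    by apply: cvgMr; apply: quartic_cvg; exact: jw.
  apply: cvg_trans h; apply: near_eq_cvg.
  apply: filterS (nbhs_infty_ger u) => n un.
  by rewrite /a mem_set//= in_itv/= u0.
Qed.

Lemma area_cvg (f w : R -> R) : measurable_fun setT f -> (forall x, 0 <= f x) -> cadlag w ->
  (forall n, area f n w <= area f n.+1 w)%E /\
  area f n w @[n --> \oo] --> killed_area f w.
Proof.
move=> mf f0 cw.
have mg (M : nat) : measurable_fun (`]0, M%:R] : set R) (fun t => (f (w t) * alive_ind w t)%:E).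
  apply/measurable_EFinP; apply: measurable_funM.
    by apply: (measurableT_comp mf); apply: right_continuous_measurable; exact: cw.1.
  by apply: right_continuous_measurable => t t0; exact: cvg_alive_ind_right.
have g0 t : (0 <= (f (w t) * alive_ind w t)%:E)%E.
  by rewrite lee_fin mulr_ge0//; have /andP[] := alive_indP w t.
have nd : nondecreasing_seq (fun n : nat => `]0, n%:R]%classic : set R).
  by move=> n k nk; apply/subsetPset => t /=; rewrite !in_itv/= => /andP[-> tn];
    rewrite (le_trans tn)// ler_nat.
have U : \bigcup_n (`]0, n%:R]%classic : set R) = `]0, +oo[%classic.
  apply/seteqP; split => t /=.
    by move=> [n _]; rewrite /= !in_itv/= andbT => /andP[].
  rewrite in_itv/= andbT => tp; exists (Num.trunc t).+1 => //=.
  by rewrite in_itv/= tp ltW//; have /andP[] := truncn_itv (ltW tp).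
split.
  move=> n; have := @ge0_nondecreasing_set_nondecreasing_integral _ _ _ _ _
    lebesgue_measure nd (fun i => measurable_itv _) mg (fun i x _ => g0 x).
  by move=> /(_ n n.+1 (leqnSn n)).
have := @ge0_nondecreasing_set_cvg_integral _ _ _ _ _ lebesgue_measure nd
  (fun i => measurable_itv _) mg (fun i x _ => g0 x).
by rewrite U.
Qed.

End QuarticLimit.

Section KilledCompensation.
Context {d : measure_display} {T : measurableType d} {R : realType}.
Context {P : probability T R}.

Lemma compensation_limit (A B : nat -> T -> \bar R) (k : nat -> \bar R)
    (A' B' : T -> \bar R) (k' : \bar R) :
  (forall n, measurable_fun setT (A n)) -> (forall n, measurable_fun setT (B n)) ->
  (forall n w, (0 <= A n w)%E) -> (forall n w, (0 <= B n w)%E) ->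
  (forall n w, (A n w <= A n.+1 w)%E) -> (forall n w, (B n w <= B n.+1 w)%E) ->
  (forall w, A n w @[n --> \oo] --> A' w) -> (forall w, B n w @[n --> \oo] --> B' w) ->
  (forall n, (0 <= k n <= k')%E) -> k n @[n --> \oo] --> k' ->
  (forall n, (\int[P]_w A n w = k n * \int[P]_w B n w)%E) ->
  [/\ measurable_fun setT A', measurable_fun setT B' &
     (\int[P]_w A' w = k' * \int[P]_w B' w)%E].
Proof.
have lim (C : nat -> T -> \bar R) (C' : T -> \bar R) :
    (forall n, measurable_fun setT (C n)) -> (forall n w, (0 <= C n w)%E) ->
    (forall n w, (C n w <= C n.+1 w)%E) -> (forall w, C n w @[n --> \oo] --> C' w) ->
    [/\ measurable_fun setT C', forall n, (0 <= \int[P]_w C n w <= \int[P]_w C' w)%E &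
      (\int[P]_w C n w)%E @[n --> \oo] --> (\int[P]_w C' w)%E].
  move=> mC C0 Cinc CC.
  have Cle w : {homo C^~ w : n m / (n <= m)%N >-> (n <= m)%E}.
    by apply/nondecreasing_seqP => n; exact: Cinc.
  have mC' : measurable_fun setT C'.
    by apply: (emeasurable_fun_cvg C) => // w _; exact: CC.
  split => //.
  - move=> n; rewrite integral_ge0//=; apply: ge0_le_integral => // w _.
    by apply: (cvge_ge_nd (a := C^~ w)); [exact: Cle|exact: CC].
  - have := @cvg_monotone_convergence _ _ _ P setT measurableT C mC
      (fun n w _ => C0 n w) (fun w _ => Cle w).
    by under eq_integral do rewrite (cvg_lim (@ereal_hausdorff R) (CC _)).
move=> mA mB A0 B0 Ainc Binc AA BB kk kl E.
have [mA' _ lA] := lim _ _ mA A0 Ainc AA.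
have [mB' bB lB] := lim _ _ mB B0 Binc BB.
split => //; rewrite -(cvg_lim (@ereal_hausdorff R) lA).
apply/cvg_lim; first exact: ereal_hausdorff.
under eq_fun do rewrite E.
exact: cvgeM_nd.
Qed.

Variables (J : R -> {RV P >-> R}) (V : {RV P >-> R}).
Variables (c sigma : R) (nu : {measure set R -> \bar R}).
Hypothesis J_levy : levy_process J.
Hypothesis V_indep : indep_systems P (sigma_RV V) (sigma_process `[0, +oo[ J).
Hypothesis nu_jump : jump_measure nu.
Hypothesis J_exponent : forall a : R, 0 <= a ->
  laplace_exponent J a = levy_exponent c sigma nu a.
Hypothesis jump_ge0 : forall w u, 0 < u -> 0 <= jump (J^~ w) u.

Let level := level J V.

Lemma quartic_compensation (m : R) (f : R -> R) (M : nat) : 0 <= m ->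
  measurable_fun setT f -> (forall x, 0 <= f x) ->
  [/\ measurable_fun setT (fun w => jump_sum f (quartic m) M (level w)),
      measurable_fun setT (fun w => area f M (level w)) &
      (\int[P]_w jump_sum f (quartic m) M (level w) =
       quartic_intensity nu m * \int[P]_w area f M (level w))%E].
Proof.
move=> m0 mf f0.
have [kb kl] := jump_intensity_quartic J_levy V_indep nu_jump J_exponent m0.
have B j : compensated P (fun w f => jump_sum f (test_fun m j) M (level w))
    (fun w f => area f M (level w)) (jump_intensity J (test_fun m j)) f.
  have [e e0 he] := test_fun_near0 m j.
  apply: (borel_compensation J_levy V_indep nu_jump J_exponent M m0 e0 he) => //.
    exact: continuous_test_fun.
  exact: test_funP.
have t0 phi u w : (forall z, 0 <= phi z) -> (0 <= (f (left_limit (level w) u) *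
    horizon_ind (level w) u * phi (jump (level w) u))%:E)%E.
  by move=> phi0; rewrite lee_fin -mulrA mulr_ge0// mulr_ge0// horizon_ind_ge0.
have tf0 j z : 0 <= test_fun m j z by have /andP[] := test_funP m j z.
apply: (@compensation_limit (fun j w => jump_sum f (test_fun m j) M (level w))
  (fun j w => area f M (level w)) (fun j => jump_intensity J (test_fun m j))) => //.
- by move=> j; have [] := B j.
- by move=> j; have [] := B j.
- by move=> j w; apply: esum_ge0 => u _; exact: t0.
- by move=> j w; apply: integral_ge0 => t _; rewrite lee_fin mulr_ge0//.
- move=> j w; apply: le_esum => u _; rewrite lee_fin ler_wpM2l//.
    by rewrite mulr_ge0// horizon_ind_ge0.
  exact: le_test_fun.
- move=> w; apply: esum_nondecreasing_cvg.
  + by move=> n u _; exact: t0.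
  + move=> n k u _ nk; rewrite lee_fin ler_wpM2l//.
      by rewrite mulr_ge0// horizon_ind_ge0.
    exact: le_test_fun.
  + move=> u _; apply: cvg_EFin; first exact: nearW.
    by apply: cvgMr; exact: test_fun_cvg.
- by move=> w; exact: cvg_cst.
- by move=> j; have [] := B j.
Qed.

Lemma level_jump_ge0 w u : 0 < u -> 0 <= jump (level w) u.
Proof. by move=> u0; rewrite /level jump_shift//; [exact: jump_ge0|exact: levy_cadlag]. Qed.

Lemma killed_compensation (f : R -> R) :
  measurable_fun setT f -> (forall x, 0 <= f x) ->
  [/\ measurable_fun setT (fun w => killed_jump_sum f (level w)),
      measurable_fun setT (fun w => killed_area f (level w)) &
      (\int[P]_w killed_jump_sum f (level w) =
       jump_rate nu * \int[P]_w killed_area f (level w))%E].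
Proof.
move=> mf f0.
have Q (n : nat) := quartic_compensation n (ler0n R n) mf f0.
have cl w : cadlag (level w) by exact: cadlag_level.
have [kle kl] := quartic_intensity_cvg nu.
apply: (@compensation_limit (fun n w => jump_sum f (quartic n%:R) n (level w))
  (fun n w => area f n (level w)) (fun n => quartic_intensity nu n%:R)) => //.
- by move=> n; have [] := Q n.
- by move=> n; have [] := Q n.
- move=> n w; apply: esum_ge0 => u _.
  by rewrite lee_fin -mulrA mulr_ge0// mulr_ge0 ?horizon_ind_ge0// quartic_ge0.
- by move=> n w; apply: integral_ge0 => t _; rewrite lee_fin mulr_ge0//.
- by move=> n w; have [] := jump_sum_cvg f0 (@level_jump_ge0 w).
- by move=> n w; have [] := area_cvg mf f0 (cl w).
- by move=> w; have [] := jump_sum_cvg f0 (@level_jump_ge0 w).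
- by move=> w; have [] := area_cvg mf f0 (cl w).
- move=> n; rewrite kle andbT; apply: integral_ge0 => y _.
  by rewrite lee_fin quartic_ge0.
- by move=> n; have [] := Q n.
Qed.

End KilledCompensation.

(** * First passage *)

Section LowerIntegral.
Context {d : measure_display} {T : measurableType d} {R : realType}.
Variable mu : {measure set T -> \bar R}.

Lemma ge0_integral_eq_off_null (N : set T) (G H : T -> \bar R) :
  measurable N -> mu N = 0%E -> (forall w, ~ N w -> G w = H w) ->
  measurable_fun setT H -> (forall w, (0 <= H w)%E) -> (forall w, (0 <= G w)%E) ->
  (\int[mu]_w G w = \int[mu]_w H w)%E.
Proof.
move=> mN N0 GH mH H0 G0.
have HN : (\int[mu]_w H w = \int[mu]_(w in setT `\` N) H w)%E.
  exact: ge0_negligible_integral.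
have mTN : measurable ([set: T] `\` N) by exact: measurableD.
apply/eqP; rewrite eq_le; apply/andP; split.
  rewrite ge0_integralTE//; apply: ge_ereal_sup => _ [h hG <-].
  have mh : measurable_fun setT (fun w => (h w)%:E) by exact/measurable_EFinP.
  rewrite -integralT_nnsfun HN (ge0_negligible_integral mN)//; last by move=> w _; rewrite lee_fin.
  apply: ge0_le_integral => //.
  - by move=> w _; rewrite lee_fin.
  - exact: measurable_funTS.
  - exact: measurable_funTS.
  - by move=> w [_ /GH <-]; exact: hG.
rewrite HN integral_mkcond ge0_integralTE; last by move=> w; rewrite patchE; case: ifP.
rewrite ge0_integralTE//; apply: ereal_sup_le => _ [h hH <-]; exists h => // w.
apply: le_trans (hH w) _; rewrite patchE; case: ifPn => //.
by rewrite inE => -[_ /GH ->].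
Qed.

(** For a nonmeasurable [G] the integral is a difference of suprema over simple
    functions, and these ignore what happens on a measurable null set. *)
Lemma integral_eq_off_null (N : set T) (G H : T -> \bar R) :
  measurable N -> mu N = 0%E -> (forall w, ~ N w -> G w = H w) ->
  measurable_fun setT H -> (forall w, (0 <= H w)%E) ->
  (\int[mu]_w G w = \int[mu]_w H w)%E.
Proof.
move=> mN N0 GH mH H0; rewrite integralE.
rewrite (ge0_integral_eq_off_null (G := G^\+%E) (H := H) mN N0)//; last first.
  move=> w /GH; rewrite funeposE => ->; exact/max_idPl.
rewrite (ge0_integral_eq_off_null (G := G^\-%E) (H := cst 0%E) mN N0)//; last first.
  by move=> w /GH; rewrite funenegE => ->; apply/max_idPr; rewrite leeNl oppe0.
by rewrite integral0 sube0.
Qed.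

End LowerIntegral.

Section FirstPassage.
Context {R : realType}.
Variable w : R -> R.
Hypothesis cw : cadlag w.
Hypothesis w0 : 0 < w 0.
Hypothesis jw : forall u, 0 < u -> 0 <= jump w u.

Lemma horizon_left_limit_ge0 u : 0 < u -> horizon w u -> 0 <= left_limit w u.
Proof.
move=> u0 hu; have h := left_limitP cw u0.
rewrite -(cvg_lim (@Rhausdorff R) h); apply: limr_ge; first exact: cvgP h.
have H0 : \forall x \near u^'-, 0 < x by exact: nbhs_left_gt.
have H1 : \forall x \near u^'-, x < u by exact: nbhs_left_lt.
by apply: filterS2 H0 H1 => x x0 xu; apply/ltW/alive_gt0; [exact: ltW|apply: hu => //; exact: ltW].
Qed.

Lemma horizon_ge0 u : 0 <= u -> horizon w u -> 0 <= w u.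
Proof.
rewrite le_eqVlt => /predU1P[<- _|u0 hu]; first exact: ltW.
have := addr_ge0 (horizon_left_limit_ge0 u0 hu) (jw u0).
by rewrite /jump addrC subrK.
Qed.

Lemma horizon_le s t : s <= t -> horizon w t -> horizon w s.
Proof. by move=> st ht v v0 vs; apply: ht => //; exact: lt_le_trans st. Qed.

Lemma alive0 : alive w 0.
Proof.
have [i wi] := inv_succ_le w0; exists i => r r0 r0'.
by have -> : r = 0 by apply/eqP; rewrite eq_le r0 r0'.
Qed.

Lemma alive_of_left_limit u : 0 < u -> horizon w u -> 0 < left_limit w u -> 0 < w u ->
  alive w u.
Proof.
move=> u0 hu l0 wu0.
have /cvgrPdist_lt/(_ (left_limit w u / 2)) := left_limitP cw u0.
rewrite divr_gt0// => /(_ isT)/near_at_left_ball[r r0 wr].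
pose x := Num.max 0 (u - r / 2).
have x0 : 0 <= x by rewrite le_max lexx.
have xu : x < u by rewrite gt_max u0 ltrBlDr ltrDl divr_gt0.
have rx : u - r < x by rewrite lt_max ltrD2l ltrN2 gtr_pMr// invf_lt1// ltr1n orbT.
have [i wi] := hu x x0 xu.
have [j wj] : exists j : nat, j.+1%:R^-1 <= left_limit w u / 2.
  by apply: inv_succ_le; rewrite divr_gt0.
have [k wk] := inv_succ_le wu0.
have le (a b : nat) : (a <= b)%N -> b.+1%:R^-1 <= a.+1%:R^-1 :> R.
  by move=> ab; rewrite lef_pV2 ?posrE// ler_nat ltnS.
exists (maxn i (maxn j k)) => t t0; rewrite le_eqVlt => /predU1P[->|tu].
  by apply: le_trans wk; apply: le; rewrite !leq_max leqnn !orbT.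
have [tx|xt] := leP t x.
  by apply: le_trans (wi t t0 tx); apply: le; rewrite !leq_max leqnn.
apply: (@le_trans _ _ (left_limit w u / 2)).
  by apply: le_trans wj; apply: le; rewrite !leq_max leqnn !orbT.
have := wr t (lt_trans rx xt) tu; rewrite ltr_norml => /andP[_]; lra.
Qed.

(** At the end of the horizon the path or its left limit is [0]. In the second
    case the path is [0] as well, unless it jumps at this time, which is what
    the hypothesis excludes. *)
Lemma until0_horizon :
  (forall u, 0 < u -> horizon w u -> left_limit w u = 0 -> jump w u <= 0) ->
  until0 w = [set u | 0 <= u /\ horizon w u].
Proof.
move=> nojump; apply/seteqP; split => u [u0 hu]; split => //; last first.
  apply: le_ereal_inf_tmp => _ [t [t0 wt] <-]; rewrite lee_fin leNgt; apply/negP => tu.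
  by have := alive_gt0 t0 (hu t t0 tu); rewrite wt ltxx.
have {}hu t : 0 <= t -> w t = 0 -> u <= t.
  move=> t0 wt; rewrite -lee_fin; apply: le_trans hu _.
  by apply: ereal_inf_lbound; exists t.
move=> v v0 vu; apply: contrapT => nv.
pose A := [set x | 0 <= x /\ alive w x].
have A0 : A 0 by split => //; exact: alive0.
have Av x : A x -> x < v.
  by move=> [_ ax]; rewrite ltNge; apply/negP => vx; apply: nv; exact: alive_le ax.
have supA : has_sup A by split; [exists 0|exists v => x /Av/ltW].
pose s := sup A.
have s0 : 0 <= s by apply: ub_le_sup => //; exact: supA.2.
have sv : s <= v by apply: ge_sup; [exists 0|move=> x /Av/ltW].
have hs : horizon w s.
  move=> x x0 xs; have xs' : 0 < s - x by rewrite subr_gt0.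
  have [y [y0 ay] +] := sup_adherent xs' supA.
  by rewrite -/s subKr => /ltW xy; exact: alive_le ay.
have ns : ~ alive w s.
  move=> as_; have H1 := alive_near_right cw s0 as_.
  have H2 : \forall x \near s^'+, s < x by exact: nbhs_right_gt.
  have H : \forall x \near s^'+, alive w x /\ s < x by apply: filterS2 H1 H2 => x ax sx.
  have [x [ax sx]] := @filter_ex _ _ (at_right_proper_filter s) _ H.
  have : A x by split => //; exact: le_trans (ltW sx).
  by move=> /(ub_le_sup supA.2); rewrite -/s leNgt sx.
have sp : 0 < s.
  by rewrite lt_neqAle s0 andbT; apply/eqP => s0'; apply: ns; rewrite -s0'; exact: alive0.
have l0 := horizon_left_limit_ge0 sp hs.
have ws0 := horizon_ge0 s0 hs.
suff ws : w s = 0 by have := hu s s0 ws; rewrite leNgt (le_lt_trans sv vu).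
apply/eqP; rewrite eq_le ws0 andbT leNgt; apply/negP => wsp.
move: l0; rewrite le_eqVlt => /predU1P[l0|lp].
  have := nojump s sp hs (esym l0); rewrite /jump -l0 subr0.
  by rewrite leNgt wsp.
by apply: ns; exact: alive_of_left_limit.
Qed.

End FirstPassage.

Section FunctionalsUntil0.
Context {R : realType}.
Variables (w f : R -> R).
Hypothesis cw : cadlag w.
Hypothesis w0 : 0 < w 0.
Hypothesis jw : forall u, 0 < u -> 0 <= jump w u.
Hypothesis until0E : until0 w = [set u | 0 <= u /\ horizon w u].
Hypothesis f_ge0 : forall x : R, 0 <= x -> 0 <= f x.
Hypothesis f_borel : measurable_fun (`[0, +oo[ : set R) f.

Let f' : R -> R := f \_ `[0, +oo[%classic.

Let f'E x : 0 <= x -> f' x = f x.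
Proof. by move=> x0; rewrite /f' patchE mem_set//= in_itv/= x0. Qed.

Lemma restrict_ge0 x : 0 <= f' x.
Proof.
by rewrite /f' patchE; case: ifPn => //; rewrite inE/= in_itv/= andbT => /f_ge0.
Qed.

Lemma measurable_restrict_ge0 : measurable_fun setT f'.
Proof. by apply/(measurable_restrictT f) => //; exact: measurable_itv. Qed.

Lemma jump_functional_killed : jump_functional f w = killed_jump_sum f' w.
Proof.
rewrite /jump_functional /killed_jump_sum esum_mkcond [RHS]esum_mkcond.
apply: eq_esum => u _; rewrite until0E.
have [up|up] := ltP 0 u; last first.
  rewrite [in RHS]memNset; last by rewrite /= in_itv/= andbT; apply/negP; rewrite -leNgt.
  rewrite memNset// => -[[u0 hu]] /=.
  by have -> : u = 0 by [apply/eqP; rewrite eq_le up u0]; rewrite /left_limit eqxx ltxx.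
rewrite [in RHS]mem_set; last by rewrite /= in_itv/= andbT.
rewrite /horizon_ind; have [hu|nhu] := pselect (horizon w u); last first.
  by rewrite asboolF// mulr0 mul0r memNset// => -[[_ hu]].
rewrite asboolT// mulr1 f'E; last exact: horizon_left_limit_ge0.
rewrite /jump subr_gt0; have [lt|ge] := ltP (left_limit w u) (w u).
  by rewrite mulr1 mem_set//; split => //; split => //; exact: ltW.
by rewrite mulr0 memNset// => -[_ /=]; rewrite ltNge ge.
Qed.

Lemma area_functional_killed : area_functional f w = killed_area f' w.
Proof.
rewrite /area_functional until0E.
pose Hz := [set u | 0 <= u /\ horizon w u].
pose A1 := [set u | 0 < u /\ alive w u].
rewrite -/Hz.
transitivity (\int[lebesgue_measure]_(t in Hz) (f' (w t))%:E)%E.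
  by apply: eq_integral => t; rewrite inE => -[t0 ht]; rewrite f'E//; exact: horizon_ge0.
have mA1 : measurable (A1 : set R).
  apply: is_interval_measurable => x y [x0 ax] [y0 ay] z /andP[xz zy].
  by split; [exact: lt_le_trans xz|exact: alive_le ay].
have mw : measurable_fun (`]0, +oo[ : set R) w.
  have -> : `]0, +oo[%classic = \bigcup_n (`]0, n%:R]%classic : set R).
    apply/seteqP; split => t /=; last by move=> [n _]; rewrite /= !in_itv/= andbT => /andP[].
    rewrite in_itv/= andbT => tp; exists (Num.trunc t).+1 => //=.
    by rewrite in_itv/= tp ltW//; have /andP[] := truncn_itv (ltW tp).
  apply/measurable_fun_bigcup => [i|i]; first exact: measurable_itv.
  by apply: right_continuous_measurable; exact: cw.1.
have mg : measurable_fun (`]0, +oo[ : set R) (fun t => (f' (w t))%:E).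
  by apply/measurable_EFinP; apply: (measurableT_comp measurable_restrict_ge0).
have A1sub : A1 `<=` `]0, +oo[%classic by move=> t [t0 _]; rewrite /= in_itv/= t0.
have mgA : measurable_fun A1 (fun t => (f' (w t))%:E).
  by apply: measurable_funS mg => //; exact: measurable_itv.
have [s sE] : exists s, A1 = (Hz `\ 0) `\ s.
  have [[s [s0 hs ns]]|no] := pselect (exists s, [/\ 0 < s, horizon w s & ~ alive w s]).
    exists s; apply/seteqP; split => t.
      move=> [t0 at_]; split; first split.
      - by split; [exact: ltW|move=> v v0 vt; apply: alive_le at_; exact: ltW].
      - by move=> /= te; rewrite te ltxx in t0.
      - by move=> /= te; apply: ns; rewrite -te.
    move=> [[[t0 ht] /= tn0] ts].
    have tp : 0 < t by rewrite lt_neqAle t0 eq_sym andbT; apply/eqP.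
    split => //; have [ts'|st|//] := ltgtP t s; first by apply: hs.
    by exfalso; apply: ns; apply: ht => //; exact: ltW.
  exists 0; apply/seteqP; split => t.
    move=> [t0 at_]; split; first split.
    - by split; [exact: ltW|move=> v v0 vt; apply: alive_le at_; exact: ltW].
    - by move=> /= te; rewrite te ltxx in t0.
    - by move=> /= te; rewrite te ltxx in t0.
  move=> [[[t0 ht] /= tn0] _].
  have tp : 0 < t by rewrite lt_neqAle t0 eq_sym andbT; apply/eqP.
  by split => //; apply: contrapT => na; apply: no; exists t.
have mHz0 : measurable (Hz `\ 0 : set R).
  apply: is_interval_measurable => x y [[x0 hx] /= xn] [[y0 hy] _] z /andP[xz zy].
  have xp : 0 < x by rewrite lt_neqAle x0 eq_sym andbT; apply/eqP.
  have zp := lt_le_trans xp xz.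
  split; first by split; [exact: ltW|exact: horizon_le hy].
  by move=> /= ze; rewrite ze ltxx in zp.
have mgHz : measurable_fun (Hz `\ 0 : set R) (fun t => (f' (w t))%:E).
  apply: measurable_funS mg; first exact: measurable_itv.
  move=> t [[t0 _] /= tn0]; rewrite /= in_itv/= andbT lt_neqAle t0 eq_sym andbT.
  exact/eqP.
rewrite -(@integral_setD1 _ _ 0)//.
rewrite -(@integral_setD1 _ _ s) -?sE//.
rewrite /killed_area -(setIidr A1sub) integral_mkcondr.
apply: eq_integral => t; rewrite inE/= in_itv/= andbT => tp.
rewrite patchE /alive_ind; have [at_|nat_] := pselect (alive w t).
  by rewrite mem_set// asboolT// mulr1.
by rewrite memNset ?asboolF ?mulr0// => -[].
Qed.

End FunctionalsUntil0.

Section NonnegativeJumps.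
Context {d : measure_display} {T : measurableType d} {R : realType}.
Context {P : probability T R}.

Lemma subordinator_plus_brownian_jump_ge0 (J : R -> {RV P >-> R}) :
  levy_process J -> subordinator_plus_brownian J ->
  forall w u, 0 < u -> 0 <= jump (J^~ w) u.
Proof.
move=> J_levy [S [B [mu [s [[S_levy S_nd] [_ [B_levy B_cont _]] _ JE]]]]] w u u0.
have cS : cadlag (S^~ w) by exact: levy_cadlag.
have cB : cadlag (B^~ w) by exact: levy_cadlag.
have cJ : cadlag (J^~ w) by exact: levy_cadlag.
have H0 : \forall x \near u^'-, 0 < x by exact: nbhs_left_gt.
have H1 : \forall x \near u^'-, x < u by exact: nbhs_left_lt.
have lB : B x w @[x --> u^'-] --> B u w.
  have Bc : {in `]0, +oo[%classic, continuous (B^~ w)}.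
    rewrite -continuous_open_subspace; last exact: interval_open.
    apply: continuous_subspaceW (B_cont w) => x /=.
    by rewrite !in_itv/= !andbT => /ltW.
  apply: cvg_at_left_filter; apply: Bc.
  by rewrite inE/= in_itv/= u0.
have lS := left_limitP cS u0.
have lJ : J x w @[x --> u^'-] --> left_limit (S^~ w) u + B u w.
  have h : S x w + B x w @[x --> u^'-] --> left_limit (S^~ w) u + B u w by exact: cvgD.
  apply: cvg_trans h; apply: near_eq_cvg; apply: filterS H0 => x x0.
  by rewrite JE// ltW.
have Sle : left_limit (S^~ w) u <= S u w.
  rewrite -(cvg_lim (@Rhausdorff R) lS); apply: limr_le; first exact: cvgP lS.
  by apply: filterS2 H0 H1 => x x0 xu; apply: S_nd; exact: ltW.
rewrite /jump subr_ge0 -(cvg_lim (@Rhausdorff R) (left_limitP cJ u0)).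
by rewrite (cvg_lim (@Rhausdorff R) lJ) (JE u w (ltW u0)) lerD2r.
Qed.

End NonnegativeJumps.

Theorem theorem2 (d : measure_display) (T : measurableType d) (R : realType)
    (P : probability T R)
    (J : R -> {RV P >-> R}) (V : {RV P >-> R})
    (c sigma : R) (nu : {measure set R -> \bar R}) (f : R -> R)
    (J_levy : levy_process J)
    (J_superposition : subordinator_plus_brownian J)
    (sigma_ge0 : 0 <= sigma)
    (nu_jump : jump_measure nu)
    (J_exponent : forall a : R, 0 <= a ->
       laplace_exponent J a = levy_exponent c sigma nu a)
    (J_mean_fin : ('E_P[J 1%R] \is a fin_num)%E)
    (J_mean_lt0 : ('E_P[J 1%R] < 0)%E)
    (V_gt0 : forall w, 0 < V w)
    (V_indep : indep_systems P (sigma_RV V) (sigma_process `[0, +oo[ J))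
    (f_ge0 : forall x : R, 0 <= x -> 0 <= f x)
    (f_borel : measurable_fun (`[0, +oo[ : set R) f) :
  let W := fun (w : T) (t : R) => V w + J t w in
  (\int[P]_w jump_functional f (W w)
   = jump_rate nu * \int[P]_w area_functional f (W w))%E.
Proof.
move=> W.
have jJ := subordinator_plus_brownian_jump_ge0 J_levy J_superposition.
have K g mg g0 := killed_compensation J_levy V_indep nu_jump J_exponent jJ (f := g) mg g0.
have cW w : cadlag (W w) by exact: cadlag_level.
have W0 w : 0 < W w 0 by rewrite /W levy_start// addr0.
have jW w u : 0 < u -> 0 <= jump (W w) u by exact: level_jump_ge0.
have alive_pos w t : 0 <= t -> alive (W w) t -> 0 < W w t by exact: alive_gt0.
(* For the indicator of the level [0] the area vanishes, whence almost surely
   no jump starts from this level at the end of the horizon. *)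
pose z : R -> R := \1_[set 0].
have z0 x : 0 <= z x by rewrite /z indicE.
have mz : measurable_fun setT z by exact: measurable_indic.
have [mD mA EDA] := K z mz z0.
pose D w := killed_jump_sum z (W w).
have D0 w : (0 <= D w)%E.
  by apply: esum_ge0 => u _; rewrite lee_fin !mulr_ge0// horizon_ind_ge0.
have ED : (\int[P]_w D w = 0)%E.
  rewrite /D EDA (eq_integral (cst 0%E)) ?integral0 ?mule0//.
  move=> w _; rewrite /killed_area (eq_integral (cst 0%E)) ?integral0//.
  move=> t; rewrite inE/= in_itv/= andbT => tp.
  rewrite /alive_ind; have [at_|nat_] := pselect (alive (W w) t); last by rewrite asboolF// mulr0.
  rewrite /z indicE memNset ?mul0r//= => Wt.
  have := alive_pos w t (ltW tp) at_.
  by have -> : W w t = 0 by [exact: Wt]; rewrite ltxx.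
have [N [mN N0 DN]] : ae_eq P setT D (cst 0%E).
  apply/ae_eq_integral_abs => //; rewrite -[RHS]ED.
  by apply: eq_integral => w _; rewrite gee0_abs.
have nojump w : ~ N w -> forall u, 0 < u -> horizon (W w) u ->
    left_limit (W w) u = 0 -> jump (W w) u <= 0.
  move=> nN u u0 hu lu; rewrite leNgt; apply/negP => ju; apply: nN; apply: DN => /= /(_ I) D0w.
  have : (1%:E <= D w)%E.
    apply: esum_ge; exists [set u].
      by split; [exact: finite_set1|move=> _ ->; rewrite /= in_itv/= u0].
    rewrite fsbig_set1 lu /z indicE mem_set// mul1r /horizon_ind asboolT// mul1r.
    by rewrite ju.
  by rewrite D0w lee_fin ler10.
have uE w : ~ N w -> until0 (W w) = [set u | 0 <= u /\ horizon (W w) u].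
  by move=> nN; exact: (until0_horizon (cW w) (W0 w) (jW w) (nojump w nN)).
pose f' : R -> R := f \_ `[0, +oo[%classic.
have f'0 x : 0 <= f' x by exact: restrict_ge0.
have mf' : measurable_fun setT f' by exact: measurable_restrict_ge0.
have [mD' mA' E'] := K f' mf' f'0.
rewrite (integral_eq_off_null (H := fun w => killed_jump_sum f' (W w)) mN N0)//; last 2 first.
- by move=> w nN; exact: (jump_functional_killed f (cW w) (uE w nN)).
- by move=> w; apply: esum_ge0 => u _; rewrite lee_fin !mulr_ge0// horizon_ind_ge0.
rewrite (integral_eq_off_null (G := fun w => area_functional f (W w))
  (H := fun w => killed_area f' (W w)) mN N0)//.
- by move=> w nN; exact: (area_functional_killed (cW w) (W0 w) (jW w) (uE w nN) f_borel).
- by move=> w; apply: integral_ge0 => t _; rewrite lee_fin mulr_ge0.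
Qed.
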